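(* Let $K\subset\mathbb{R}^n$ be a body, and let $\mathcal{E}$ be its Löwner-John ellipsoid. Then for any ellipsoid $\mathcal{F}\subset K$, $$M^*_{\mathcal{E}}(\mathcal{F})\le 1.$$ Equality holds for $\mathcal{F}=\mathcal{E}$, but there may be additional cases of equality: there exist $n$, a body $K\subset\mathbb{R}^n$ with Löwner-John ellipsoid $\mathcal{E}$, and an ellipsoid $\mathcal{F}\subset K$ with $\mathcal{F}\ne\mathcal{E}$ and $M^*_{\mathcal{E}}(\mathcal{F})=1$.
   Context: A body in $\mathbb{R}^n$ is a compact convex set $K$ with $K=-K$ and non-empty interior; $\|x\|_K=\inf\{\lambda>0: x\in\lambda K\}$ is the norm with unit ball $K$. An ellipsoid means a centrally-symmetric (centered at the origin), non-degenerate ellipsoid. The Löwner-John ellipsoid of $K$ is the (unique) ellipsoid of maximal volume contained in $K$. For an ellipsoid $\mathcal{E}$, $\langle\cdot,\cdot\rangle_{\mathcal{E}}$ is the unique scalar product on $\mathbb{R}^n$ with $\mathcal{E}=\{x:\langle x,x\rangle_{\mathcal{E}}\le 1\}$, and $\mu_{\mathcal{E}}$ is the unique Borel probability measure on $\partial\mathcal{E}$ invariant under all linear isometries of $(\mathbb{R}^n,\langle\cdot,\cdot\rangle_{\mathcal{E}})$. For a body $K$, $M_{\mathcal{E}}(K)=\left(\int_{\partial\mathcal{E}}\|x\|_K^2\,d\mu_{\mathcal{E}}(x)\right)^{1/2}$, $K_{\mathcal{E}}^{\circ}=\{x\in\mathbb{R}^n:\forall y\in K,\ \langle x,y\rangle_{\mathcal{E}}\le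 1\}$, and $M^*_{\mathcal{E}}(K)=M_{\mathcal{E}}(K_{\mathcal{E}}^{\circ})$. *)

(* Defs.v *)
From HB Require Import structures.
From mathcomp Require Import all_boot all_order all_algebra.
From mathcomp Require Import all_classical all_reals all_analysis.
Set Implicit Arguments.
Unset Strict Implicit.
Unset Printing Implicit Defensive.
Import Order.TTheory GRing.Theory Num.Theory.
Import numFieldNormedType.Exports.
Local Open Scope classical_set_scope.
Local Open Scope ring_scope.

Definition borel_rV (R : realType) (n : nat) :=
  g_sigma_algebraType (@open 'rV[R]_n).

(* Lebesgue measure of R^n as an iterated product measure. It is meaningful on
   Borel sets only: elsewhere the integral defining the library's product
   measure carries no information. *)
Fixpoint volume (R : realType) (n : nat) : set 'rV[R]_n -> \bar R :=
  match n with
  | 0 => fun A => @dirac _ (borel_rV R 0) 0 R A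
  | m.+1 => fun A =>
      @product_measure1 _ _ (measurableTypeR R) (borel_rV R m) R
        lebesgue_measure (@volume R m)
        ((fun p : R * 'rV[R]_m => row_mx (p.1%:M : 'rV[R]_1) p.2) @^-1` A)
  end.

Section bodies.
Variables (R : realType) (n : nat).
Local Notation V := 'rV[R]_n.
Implicit Types (K E : set V) (x y : V) (b : V -> V -> R).

Definition is_body K :=
  [/\ compact K, convex_set (K : set (convex_lmodType V)),
      K = [set - x | x in K] & K° !=set0].

Definition body_norm K x : R :=
  inf [set l | 0 < l /\ [set l *: y | y in K] x].

Definition scalar_product b := exists f : {dot V for idfun}, b = f.

Definition unit_ball b : set V := [set x | b x x <= 1].

Definition is_ellipsoid E := exists2 b, scalar_product b & E = unit_ball b.

Definition is_Loewner_John K E :=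
  [/\ is_ellipsoid E, E `<=` K &
      forall F, is_ellipsoid F -> F `<=` K -> (volume F <= volume E)%E].

Definition ellipsoid_dot E : V -> V -> R :=
  get [set b | scalar_product b /\ E = unit_ball b].

Definition boundary E : set V := closure E `\` E°.

Definition isometry_invariant b (mu : probability (borel_rV R n) R) :=
  forall T : {linear V -> V}, (forall x y, b (T x) (T y) = b x y) ->
  forall A : set (borel_rV R n), measurable A -> mu (T @^-1` A) = mu A.

(* Borel probability measures on the boundary of E are represented by the Borel
   probability measures on R^n that are carried by this boundary. *)
Definition ellipsoid_measure E : probability (borel_rV R n) R :=
  get [set mu : probability (borel_rV R n) R |
        mu (boundary E) = 1%E /\ isometry_invariant (ellipsoid_dot E) mu].

Definition ellipsoid_M E K : \bar R :=
  sqrte (\int[ellipsoid_measure E]_(x in boundary E)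
           ((body_norm K x) ^+ 2)%:E)%E.

Definition polar E K : set V :=
  [set x | forall y, K y -> ellipsoid_dot E x y <= 1].

Definition ellipsoid_Mstar E K : \bar R := ellipsoid_M E (polar E K).

End bodies.

(* Main.v *)
(* An ellipsoid is {x | x M x^T <= 1} with M symmetric positive definite; up to
   a constant, its volume is (det M)^(-1/2).  If E and F correspond to M and N,
   the invariance of the measure on the boundary of E under sign changes and
   permutations of E-orthonormal coordinates gives
   M*_E(F)^2 = tr (M N^-1) / n, so equality for F = E is clear.  For 0 < t < 1
   the ellipsoid with matrix ((1 - t) M^-1 + t N^-1)^-1 lies in the convex hull
   of E and F, hence in K; maximality of E gives
   det ((1 - t) I + t M N^-1) <= 1, and letting t tend to 0,
   tr (M N^-1) <= n.  For the square [-1, 1]^2 maximality of the disc is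
   Hadamard's inequality, and any inscribed ellipse touching all four sides
   is a case of equality.
   A measure on the boundary of E with the required invariance exists: it is the
   radial projection of Lebesgue measure on E, invariant because a linear map
   multiplies Lebesgue measure by a constant, which is 1 for isometries of E. *)
Require Import Defs.
From HB Require Import structures.
From mathcomp Require Import all_boot all_order all_algebra.
From mathcomp Require Import all_classical all_reals all_analysis.
From mathcomp Require Import measurable_realfun.
From mathcomp Require Import ring lra.
From mathcomp Require polyrcf.
Set Implicit Arguments.
Unset Strict Implicit.
Unset Printing Implicit Defensive.
Import Order.TTheory GRing.Theory Num.Theory.
Import numFieldNormedType.Exports.
Local Open Scope classical_set_scope.
Local Open Scope ring_scope.
(** * Lebesgue measure on row vectors *)

(* The measure instance on [pushforward] needs the measurability of [f], which
   unification does not find by itself. *)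
Definition image_measure (R : realType) d d' (T1 : measurableType d)
  (T2 : measurableType d') (m : {measure set T1 -> \bar R}) (f : T1 -> T2)
  (mf : measurable_fun [set: T1] f) : {measure set T2 -> \bar R}.
Proof. by refine (pushforward m f : {measure set T2 -> \bar R}). Defined.

(* [product_measure1] of sigma-finite measures is not recognized as
   sigma-finite: another canonical instance takes precedence. *)
Section SigmaFiniteMeasureOf.
Context (R : realType) d (T : measurableType d) (P : {measure set T -> \bar R}).
Hypothesis sP : sigma_finite setT P.
Let Q : set T -> \bar R := P.
HB.instance Definition _ := Measure.on Q.
HB.instance Definition _ := Measure_isSigmaFinite.Build _ _ _ Q sP.

Lemma sigma_finite_measure_of :
  exists S : {sigma_finite_measure set T -> \bar R},
    S = P :> (set T -> \bar R).
Proof. by exists Q. Qed.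

End SigmaFiniteMeasureOf.

Section MeasurableRV.
Variable R : realType.

(** Balls with rational centre and radius [k.+1%:R^-1] form a countable base. Replacing those not
    contained in [O] by the empty set keeps a countable index type that does not depend on [O]. *)
Lemma open_rV_bigcup n (O : set 'rV[R]_n) : open O ->
  O = \bigcup_(p : 'rV[rat]_n * nat)
        (if pselect (ball (map_mx ratr p.1 : 'rV[R]_n) (p.2.+1%:R^-1) `<=` O)
         then ball (map_mx ratr p.1 : 'rV[R]_n) (p.2.+1%:R^-1) else set0).
Proof.
move=> oO; apply/seteqP; split=> [x Ox|x [p _]]; last first.
  by case: pselect => // sub /sub.
have /nbhs_ballP[e /= e0 xO] : nbhs x O by exact: open_nbhs_nbhs.
have [k ke] : exists k : nat, k.+1%:R^-1 < e / 2.
  have := @ltr_add_invr R 0 (e / 2); rewrite divr_gt0// => /(_ isT)[k];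
    rewrite add0r; by exists k.
have k0 : 0 < k.+1%:R^-1 :> R by rewrite invr_gt0.
have [q qP] : exists q : 'rV[rat]_n, ball (map_mx ratr q : 'rV[R]_n) (k.+1%:R^-1) x.
  have H i : {r : rat | `|ratr r - x 0 i| < k.+1%:R^-1}.
    apply/cid; have : x 0 i - k.+1%:R^-1 < x 0 i + k.+1%:R^-1 by rewrite ltrD2l gt0_cp.
    move=> /rat_in_itvoo[r]; rewrite in_itv/= => rP; exists r.
    by rewrite ltr_distl.
  exists (\row_i projT1 (H i)); split => // i j; rewrite !mxE (ord1 i).
  exact: projT2 (H j).
exists (q, k) => //=; case: pselect => // -[]; apply: subset_trans xO.
move=> y qy; apply: (@le_ball _ _ _ (k.+1%:R^-1 + k.+1%:R^-1)).
  by rewrite (splitr e) lerD// ltW.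
by apply: ball_triangle qy; exact: ball_sym.
Qed.

Lemma measurable_coord n (i : 'I_n) :
  measurable_fun [set: borel_rV R n] (fun x : borel_rV R n => x 0 i : R).
Proof.
apply: (measurability (@RGenOpens.G R)); first exact: RGenOpens.measurableE.
move=> ? [B oB <-]; rewrite setTI; apply: sub_sigma_algebra.
have {oB} : open (B : set R) by case: oB => a [b ->]; exact: interval_open.
by move: B; apply/continuousP; exact: coord_continuous.
Qed.

(** Balls of the sup norm are products of intervals, so the preimage of a ball is a finite
    intersection of coordinate preimages; open sets are countable unions of balls. *)
Lemma measurable_fun_rV d (T : measurableType d) n (f : T -> 'rV[R]_n) :
  (forall i, measurable_fun [set: T] (fun x => f x 0 i)) ->
  measurable_fun [set: T] (f : T -> borel_rV R n).
Proof.
move=> mf; apply: (@measurability _ _ _ (borel_rV R n) _ _ (@open 'rV[R]_n)) => //.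
move=> ? [U oU <-]; rewrite setTI (open_rV_bigcup oU) preimage_bigcup.
apply: countable_bigcupT_measurable; first exact: countableP.
move=> p; case: pselect => sub /=; last by rewrite preimage_set0.
rewrite [X in measurable X](_ : _ = \big[setI/setT]_(i < n)
    ((fun x => f x 0 i) @^-1` ball (ratr (p.1 0 i) : R) p.2.+1%:R^-1)).
  apply: bigsetI_measurable => i _; rewrite -[X in measurable X]setTI.
  by apply: mf => //; exact: measurable_ball.
rewrite -bigcap_seq.
apply/seteqP; split=> x /=.
  by move=> [_ h] i _; have := h 0 i; rewrite mxE.
by move=> h; split => [|i j]; rewrite ?invr_gt0// mxE (ord1 i); apply: h;
  rewrite /= mem_index_enum.
Qed.

Lemma measurable_rV0 (A : set (borel_rV R 0)) : measurable A.
Proof.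
apply: sub_sigma_algebra.
have [->|/set0P[x Ax]] := eqVneq A set0; first exact: open0.
rewrite (_ : A = setT); first exact: openT.
by apply/seteqP; split=> // y _; rewrite (_ : y = x)//; apply/rowP => -[].
Qed.
 

Definition consrow m (p : measurableTypeR R * borel_rV R m) : borel_rV R m.+1 :=
  row_mx (p.1%:M : 'rV[R]_1) (p.2 : 'rV[R]_m).

Lemma measurable_consrow m : measurable_fun setT (@consrow m).
Proof.
apply: (@measurable_fun_rV _ _ m.+1) => i.
have [j ->|j ->] := @split_ordP 1 m i.
  rewrite [X in measurable_fun _ X](_ : _ = fst); first exact: measurable_fst.
  by apply/funext => p; rewrite (@row_mxEl _ 1 1 m) (ord1 j) mxE eqxx mulr1n.
rewrite [X in measurable_fun _ X](_ : _ = fun p => (p.2 : 'rV_m) 0 j); last first.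
  by apply/funext => p; rewrite (@row_mxEr _ 1 1 m).
exact: (measurableT_comp (measurable_coord j) measurable_snd).
Qed.

Lemma measurable_uncons m : measurable_fun [set: borel_rV R m.+1]
  (fun x : borel_rV R m.+1 => ((x : 'rV_(1 + m)) 0 (lshift m 0),
     rsubmx (x : 'rV_(1 + m)) : borel_rV R m)).
Proof.
apply: measurable_fun_pair; first exact: measurable_coord.
apply: measurable_fun_rV => i; under eq_fun do rewrite mxE.
exact: measurable_coord.
Qed.

(** Induction on [n]: the next measure is the image under [consrow] of a product with Lebesgue
    measure. Agreement with [volume] is claimed for measurable [A] only, since the induction
    hypothesis applies to measurable sections. *)
Lemma volume_measure n :
  exists l : {sigma_finite_measure set (borel_rV R n) -> \bar R},
    forall A, measurable A -> l A = volume A.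
Proof.
elim: n => [|m [l lE]].
  by exists (@dirac _ (borel_rV R 0) 0 R).
pose c := @consrow m.
pose u := (fun x : borel_rV R m.+1 => ((x : 'rV_(1 + m)) 0 (lshift m 0),
     rsubmx (x : 'rV_(1 + m)) : borel_rV R m)).
have mc : measurable_fun setT c by exact: measurable_consrow.
have mu : measurable_fun setT u by exact: measurable_uncons.
have cK : cancel c u.
  by move=> [x y]; rewrite /c /u /consrow row_mxEl mxE eqxx mulr1n row_mxKr.
pose P := image_measure (@lebesgue_measure R \x l)%E mc.
have sP : sigma_finite setT P.
  have /sigma_finiteP[F [FT ndF Foo]] := sigma_finiteT (@lebesgue_measure R).
  have /sigma_finiteP[G [GT ndG Goo]] := sigma_finiteT l.
  exists (fun n => u @^-1` (F n `*` G n)).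
    rewrite -preimage_bigcup (_ : \bigcup_n _ = setT) ?preimage_setT//.
    apply/seteqP; split=> // -[x y] _.
    have : [set: measurableTypeR R] x by []. have : [set: borel_rV R m] y by [].
    (* Both exhausting sequences increase, so the larger of the two indices serves both
       coordinates. *)
    rewrite FT GT => -[i _ Gi] [j _ Fj]; exists (maxn i j) => //; split => /=.
      by move: x Fj; exact/subsetPset/ndF/leq_maxr.
    by move: y Gi; exact/subsetPset/ndG/leq_maxl.
  move=> n; have [mF oF] := Foo n; have [mG oG] := Goo n; split.
    by rewrite -[X in measurable X]setTI; apply: mu => //; exact: measurableX.
  rewrite /P /= /pushforward -comp_preimage (_ : u \o c = id) ?preimage_id; last first.
    by apply/funext => p; exact: cK.
  by rewrite product_measure1E// lte_mul_pinfty// ge0_fin_numE.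
have [Q QP] := sigma_finite_measure_of sP.
exists Q => A mA; rewrite QP /= /pushforward.
apply: eq_integral => x _ /=; rewrite lE//.
apply: measurable_xsection; rewrite -[X in measurable X]setTI.
exact: measurable_consrow.
Qed.

Definition lebesgue_rV n := projT1 (cid (volume_measure n)).

Lemma lebesgue_rVE n (A : set (borel_rV R n)) :
  measurable A -> lebesgue_rV n A = volume A.
Proof. exact: projT2 (cid (volume_measure n)) A. Qed.

Lemma lebesgue_rVS m (A : set (borel_rV R m.+1)) : measurable A ->
  lebesgue_rV m.+1 A = (@lebesgue_measure R \x lebesgue_rV m)%E
    (@consrow m @^-1` A).
Proof.
move=> mA; rewrite lebesgue_rVE//=.
apply: eq_integral => x _ /=; rewrite lebesgue_rVE//.
apply: measurable_xsection; rewrite -[X in measurable X]setTI.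
exact: measurable_consrow.
Qed.

Lemma measurable_rsubX m (A : set (measurableTypeR R)) (B : set (borel_rV R m)) :
  measurable A -> measurable B ->
  measurable ([set x | A ((x : 'rV_(1 + m)) 0 (lshift m 0)) /\
    B (rsubmx (x : 'rV_(1 + m)))] : set (borel_rV R m.+1)).
Proof.
move=> mA mB; rewrite [X in measurable X](_ : _ =
  (fun x : borel_rV R m.+1 => ((x : 'rV_(1 + m)) 0 (lshift m 0),
     rsubmx (x : 'rV_(1 + m)) : borel_rV R m)) @^-1` (A `*` B))//.
rewrite -[X in measurable X]setTI; apply: measurable_uncons => //.
exact: measurableX.
Qed.

Lemma lebesgue_rVX m (A : set (measurableTypeR R)) (B : set (borel_rV R m)) :
  measurable A -> measurable B ->
  lebesgue_rV m.+1 [set x | A ((x : 'rV_(1 + m)) 0 (lshift m 0)) /\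
    B (rsubmx (x : 'rV_(1 + m)))] =
  (lebesgue_measure A * lebesgue_rV m B)%E.
Proof.
move=> mA mB; rewrite lebesgue_rVS; last exact: measurable_rsubX.
rewrite -product_measure1E//; congr (_ _).
by apply/seteqP; split=> -[x y] /=;
  rewrite /consrow (@row_mxEl _ 1 1 m) mxE eqxx mulr1n (@row_mxKr _ 1 1 m).
Qed.

Lemma lebesgue_measure_shift (a : R) (A : set (measurableTypeR R)) : measurable A ->
  lebesgue_measure ((fun x => x + a) @^-1` A) = lebesgue_measure A.
Proof.
move=> mA.
have ms : measurable_fun setT ((fun x =>
  x + a) : measurableTypeR R -> measurableTypeR R).
  exact: measurable_funD.
apply/esym.
apply: (lebesgue_measure_unique (mu := image_measure (@lebesgue_measure R) ms)) =>
  //= _ [[x y]] _ <-.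
rewrite /= /pushforward (_ : _ @^-1` _ = `]x - a, y - a]%classic).
  by rewrite !lebesgue_measure_itv/= !lte_fin ltrD2r; case: ifP => // _;
    rewrite -!EFinB opprB addrA addrNK.
by apply/seteqP; split=> z /=; rewrite !in_itv/= ltrBlDr lerBrDr.
Qed.

Lemma measurable_shift n (v : 'rV[R]_n) : measurable_fun setT (fun x : borel_rV R n
  => x + v : borel_rV R n).
Proof.
apply: measurable_fun_rV => i; under eq_fun do rewrite mxE.
by apply: measurable_funD => //; exact: measurable_coord.
Qed.

(** Induction on the dimension: the translated product measure takes the same values on rectangles,
    and these determine it. *)
Lemma lebesgue_rV_shift n (v : 'rV[R]_n) (A : set (borel_rV R n)) : measurable A ->
  lebesgue_rV n ((fun x : 'rV_n => x + v) @^-1` A) = lebesgue_rV n A.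
Proof.
elim: n v A => [|m IH] v A mA.
  by congr (_ _); apply/seteqP; split=> x /=; rewrite (_ : x + v = x)//;
    apply/rowP => -[].
have mA' : measurable ((fun x : 'rV_m.+1 => x + v) @^-1` A : set (borel_rV R m.+1)).
  by rewrite -[X in measurable X]setTI; exact: measurable_shift.
rewrite !lebesgue_rVS//.
set c := @consrow m.
have mcA : measurable (c @^-1` A).
  by rewrite -[X in measurable X]setTI; exact: measurable_consrow.
pose a := (v : 'rV_(1 + m)) 0 (lshift m 0); pose w := rsubmx (v : 'rV_(1 + m)).
pose T := fun p : measurableTypeR R * borel_rV R m =>
  (p.1 + a : measurableTypeR R, p.2 + w : borel_rV R m).
have mT : measurable_fun setT T.
  apply: measurable_fun_pair; first by apply: measurable_funD => //;
    exact: measurable_fst.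
  exact: (measurableT_comp (measurable_shift w) measurable_snd).
rewrite [in RHS](@product_measure_unique _ _ _ _ R lebesgue_measure (lebesgue_rV m)
  (image_measure (@lebesgue_measure R \x lebesgue_rV m)%E mT))//.
  rewrite /= /pushforward; congr (_ _); apply/seteqP.
  have E p : c (T p) = c p + v.
    rewrite /c /T /consrow /= -[v in RHS](@hsubmxK _ 1 1 m) (@add_row_mx _ 1 1 m).
    apply: (congr2 (@row_mx _ 1 1 m)) => //.
    by apply/rowP => i; rewrite (ord1 i) !mxE eqxx !mulr1n.
  by split=> p /=; rewrite E.
move=> B C mB mC; rewrite /= /pushforward.
rewrite (_ : T @^-1` _ = ((fun x => x + a) @^-1` B) `*` ((fun x : 'rV_m =>
  x + w) @^-1` C))//.
have mB' : measurable ((fun x => x + a) @^-1` B : set (measurableTypeR R)).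
  by rewrite -[X in measurable X]setTI; apply: measurable_funD.
have mC' : measurable ((fun x : 'rV_m => x + w) @^-1` C : set (borel_rV R m)).
  by rewrite -[X in measurable X]setTI; exact: measurable_shift.
by rewrite product_measure1E//= IH//; congr (_ * _)%E; exact: lebesgue_measure_shift.
Qed.

(** The closed ball of the sup norm. Radius 1 gives the reference set for volume scaling and the
    body of the equality example; radius 0 gives the origin. *)
Definition cube n (r : R) : set (borel_rV R n) := [set x | forall i, `|x 0 i| <= r].
Arguments cube n r : clear implicits.

Lemma cubeS m r : cube m.+1 r =
   [set x | `[-r, r]%classic ((x : 'rV_(1 + m)) 0 (lshift m 0)) /\
     cube m r (rsubmx (x : 'rV_(1 + m)))].
Proof.
apply/seteqP; split=> x /=.
  by move=> h; split=> [|i]; rewrite ?in_itv/= -?ler_norml ?mxE; exact: h.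
rewrite in_itv/= -ler_norml => -[h0 h] i; have [j ->|j ->] := @split_ordP 1 m i.
  by rewrite (ord1 j).
by have := h j; rewrite mxE.
Qed.

Lemma measurable_cube n r : measurable (cube n r).
Proof.
elim: n => [|m IH]; first exact: measurable_rV0.
by rewrite cubeS; exact: measurable_rsubX.
Qed.

Lemma lebesgue_rV_cube n (r : R) : 0 <= r ->
  lebesgue_rV n (cube n r) = ((r *+ 2) ^+ n)%:E.
Proof.
move=> r0; elim: n => [|m IH].
  rewrite lebesgue_rVE /=; last exact: measurable_rV0.
  by rewrite diracE mem_set// => -[].
rewrite cubeS lebesgue_rVX//; last exact: measurable_cube.
rewrite IH lebesgue_measure_itv/= lte_fin exprS EFinM.
case: ifPn => [_|]; first by rewrite -EFinB opprK mulr2n.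
rewrite -leNgt => h; have -> : r = 0 by apply/eqP; rewrite eq_le r0 andbT; lra.
by rewrite mul0rn !mul0e.
Qed.

End MeasurableRV.
Arguments cube {R} n r.

(** * Volume scaling of linear maps *)

Lemma integral_if_cst (R : realType) d (T : measurableType d) (m : {measure set T
  -> \bar R})
  (B : set T) (k : \bar R) : measurable B ->
  (\int[m]_y (if y \in B then k else 0) = k * m B)%E.
Proof. by move=> mB; rewrite -integral_mkcond integral_cst. Qed.

Section LinearImage.
Variable R : realType.
Local Notation lam := (@lebesgue_rV R _).

Lemma measurable_mulmx n p (S : 'M[R]_(n, p)) :
  measurable_fun setT (fun x : borel_rV R n => x *m S : borel_rV R p).
Proof.
apply: measurable_fun_rV => i; under eq_fun do rewrite mxE.
by apply: measurable_sum => j; apply: measurable_funM => //; exact: measurable_coord.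
Qed.

(** Linear maps act on sets by preimage, which makes measurability immediate and turns the
    congruence [S *m M *m S^T] into the action of [S] on ellipsoids. *)
Definition premx n p (S : 'M[R]_(n, p)) (A : set 'rV[R]_p) : set (borel_rV R n) :=
  [set x | A ((x : 'rV_n) *m S)].

Lemma measurable_preimage_mulmx n p (S : 'M[R]_(n, p)) (A : set (borel_rV R p)) :
  measurable A -> measurable (premx S A).
Proof. by move=> mA; rewrite -[X in measurable X]setTI; exact: measurable_mulmx. Qed.

Lemma measurable_rVD d (T : measurableType d) n (f g : T -> borel_rV R n) :
  measurable_fun setT f -> measurable_fun setT g ->
  measurable_fun setT (fun x => (f x : 'rV_n) + g x : borel_rV R n).
Proof.
move=> mf mg; apply: measurable_fun_rV => i; under eq_fun do rewrite mxE.
by apply: measurable_funD; exact: (measurableT_comp (measurable_coord i)).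
Qed.

Lemma lebesgue_rV_swap n (C : set (borel_rV R n * borel_rV R n)) : measurable C ->
  (@lebesgue_rV R n \x @lebesgue_rV R n)%E C = (@lebesgue_rV R n \x^ @lebesgue_rV R
    n)%E C.
Proof.
move=> mC; apply: product_measure_unique => // A B mA mB; exact: product_measure2E.
Qed.

(* Both sides are the product measure of {(x, y) | x S + y in A, y in B},
   computed with Fubini in the two orders. *)
Lemma lebesgue_rV_mulmx n (S : 'M[R]_n) (A B : set (borel_rV R n)) : S \in unitmx ->
  measurable A -> measurable B ->
  (lam (premx S A) * lam B =
   lam A * lam (premx (- S) B))%E.
Proof.
move=> uS mA mB.
have mS : measurable_fun setT (fun p : borel_rV R n * borel_rV R n =>
  p.1 *m S : borel_rV R n).
  exact: (measurableT_comp (measurable_mulmx S) measurable_fst).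
have mNS : measurable_fun setT (fun p : borel_rV R n * borel_rV R n =>
  p.1 *m - S : borel_rV R n).
  exact: (measurableT_comp (measurable_mulmx (- S)) measurable_fst).
pose C : set (borel_rV R n * borel_rV R n) := [set p | A (p.1 *m S + p.2) /\ B p.2].
pose D : set (borel_rV R n * borel_rV R n) := [set p | A p.2 /\ B (p.1 *m - S + p.2)].
have mC : measurable C.
  have -> : C = [set p | A (p.1 *m S + p.2)] `&` [set p | B p.2] by [].
  apply: measurableI.
    rewrite -[X in measurable X]setTI; apply: (measurable_rVD mS measurable_snd) => //.
  by rewrite -[X in measurable X]setTI; exact: measurable_snd.
have mD : measurable D.
  have -> : D = [set p | A p.2] `&` [set p | B (p.1 *m - S + p.2)] by [].
  apply: measurableI.
    by rewrite -[X in measurable X]setTI; exact: measurable_snd.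
  rewrite -[X in measurable X]setTI; apply: (measurable_rVD mNS measurable_snd) => //.
(* The shear along [x *m S]: for fixed [x], the section of [C] is a translate of the section of
   [D]. *)
have CD : ((@lebesgue_rV R n) \x (@lebesgue_rV R n))%E C = ((@lebesgue_rV R n) \x
  (@lebesgue_rV R n))%E D.
  apply: eq_integral => x _ /=.
  rewrite -[in RHS](@lebesgue_rV_shift _ _ (x *m S)); last exact: measurable_xsection.
  by congr (lam _); apply/seteqP; split=> y; rewrite /= !xsectionE /C /D /= mulmxN
    [- (x *m S) + _]addrC addrK [(y : 'rV_n) + x *m S]addrC.
(* The preimage under an affine map is the preimage under its linear part, translated by
   [u *m invmx T]. *)
have shS (u : 'rV_n) (E : set (borel_rV R n)) (T : 'M[R]_n) : T \in unitmx ->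
  measurable E ->
    lam ((fun x : 'rV_n => x *m T + u) @^-1` E) = lam (premx T E).
  move=> uT mE; rewrite -[in RHS](@lebesgue_rV_shift _ _ (u *m invmx T));
    last exact: measurable_preimage_mulmx.
  by congr (lam _); apply/seteqP; split=> x /=; rewrite /premx /= mulmxDl mulmxKV.
move: CD; rewrite !lebesgue_rV_swap// /product_measure2.
rewrite (eq_integral (fun y => if y \in B then lam (premx S A) else 0%E)); last first.
  move=> y _ /=; case: ifPn => [/set_mem By|/negP yB].
    rewrite -(shS y)//; congr (lam _); apply/seteqP; split=> x;
      rewrite /= ysectionE /C /=; tauto.
  rewrite (_ : ysection _ _ = set0) ?measure0//; apply/seteqP; split=> x //.
  by rewrite ysectionE /C /= => -[_ /mem_set].
rewrite integral_if_cst// => ->.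
rewrite (eq_integral (fun y => if y \in A then lam (premx (- S) B) else 0%E));
  last first.
  move=> y _ /=; case: ifPn => [/set_mem Ay|/negP yA].
    rewrite -(shS y)//; last by rewrite -scaleN1r unitmxZ// unitrN unitr1.
    congr (lam _); apply/seteqP; split=> x; rewrite /= ysectionE /D /=; tauto.
  rewrite (_ : ysection _ _ = set0) ?measure0//; apply/seteqP; split=> x //.
  by rewrite ysectionE /D /= => -[/mem_set].
by rewrite integral_if_cst// muleC.
Qed.

Lemma lebesgue_rV_bounded n (r : R) (A : set (borel_rV R n)) : measurable A ->
  A `<=` cube n r -> (lam A < +oo)%E.
Proof.
move=> mA Ar.
have Ar' : A `<=` cube n `|r| by move=> x /Ar h i; apply: (le_trans (h i));
  exact: ler_norm.
apply: (@le_lt_trans _ _ (lam (cube n `|r|))); last by rewrite lebesgue_rV_cube// ltry.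
by rewrite le_measure// inE//; exact: measurable_cube.
Qed.

Lemma preimage_mulmx_bounded n (S : 'M[R]_n) r : S \in unitmx -> exists r',
  premx S (cube n r) `<=` cube n r'.
Proof.
(* A crude radius: its [i]-th inner sum already bounds coordinate [i] of [x *m S *m invmx S]. *)
move=> uS; exists (\sum_i \sum_j `|r| * `|invmx S j i|) => x /= xr i.
rewrite -[x](mulmxK uS) mxE; apply: (le_trans (ler_norm_sum _ _ _)).
rewrite [leRHS](bigD1 i)//= ler_wpDr//.
  by apply: sumr_ge0 => k _; apply: sumr_ge0 => l _; rewrite mulr_ge0.
apply: ler_sum => j _; rewrite normrM ler_wpM2r//.
by apply: (le_trans (xr j)); exact: ler_norm.
Qed.

Lemma lebesgue_rV_cube1 n : lam (cube n 1) = (2 ^+ n)%:E :> \bar R.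
Proof. by rewrite lebesgue_rV_cube. Qed.

(* Equal to [`|\det S|^-1]; [cholesky] proves this for one square root [S] of
   each positive definite matrix, which is enough. *)
Definition vol_factor n (S : 'M[R]_n) : R :=
  fine (lam (premx S (cube n 1))) / 2 ^+ n.

Lemma premx_cube_fin n (S : 'M[R]_n) : S \in unitmx ->
  lam (premx S (cube n 1)) \is a fin_num.
Proof.
move=> uS; have [r Hr] := preimage_mulmx_bounded 1 uS.
rewrite ge0_fin_numE//; apply: lebesgue_rV_bounded Hr.
exact: measurable_preimage_mulmx (@measurable_cube R n 1).
Qed.

(** The exchange identity with [B] the unit cube: the cube is symmetric, so [- S] and [S] have the
    same preimage of it, and its measure [2 ^+ n] can be divided out. *)
Lemma lebesgue_premx n (S : 'M[R]_n) (A : set (borel_rV R n)) : S \in unitmx ->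
  measurable A -> lam (premx S A) = (lam A * (vol_factor S)%:E)%E.
Proof.
move=> uS mA; have := lebesgue_rV_mulmx uS mA (@measurable_cube R n 1).
have -> : premx (- S) (cube n 1) = premx S (cube n 1).
  have E (x : 'rV_n) i : `|(x *m - S) 0 i| = `|(x *m S) 0 i|.
    by rewrite mulmxN mxE normrN.
  by apply/seteqP; split=> x h i; have := h i; rewrite /premx /= E.
have fin := premx_cube_fin uS.
rewrite lebesgue_rV_cube1 /vol_factor -(fineK fin) /= => H.
by rewrite EFinM muleA -H -muleA -EFinM divff ?mule1// expf_neq0// pnatr_eq0.
Qed.

Lemma vol_factorM n (S T : 'M[R]_n) : S \in unitmx -> T \in unitmx ->
  vol_factor (S *m T) = vol_factor S * vol_factor T.
Proof.
move=> uS uT; rewrite {1}/vol_factor.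
have -> : premx (S *m T) (cube n 1) = premx S (premx T (cube n 1)).
  by apply/seteqP; split=> x; rewrite /premx /= mulmxA.
rewrite lebesgue_premx//; last exact: measurable_preimage_mulmx (@measurable_cube R
  n 1).
rewrite lebesgue_premx//; last exact: measurable_cube.
rewrite lebesgue_rV_cube1 -!EFinM /=; field.
by rewrite expf_neq0// pnatr_eq0.
Qed.

Lemma vol_factor_ge0 n (S : 'M[R]_n) : 0 <= vol_factor S.
Proof. by rewrite divr_ge0// ?exprn_ge0// fine_ge0. Qed.

(** The measure of [E] cancels in the scaling formula. With an ellipsoid for [E], its linear
    isometries preserve volume, without any determinant. *)
Lemma vol_factor_id n (S : 'M[R]_n) (E : set (borel_rV R n)) : S \in unitmx ->
  measurable E -> (0 < lam E < +oo)%E -> premx S E = E -> vol_factor S = 1.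
Proof.
move=> uS mE /andP[E0 Eoo] SE; have := lebesgue_premx uS mE; rewrite SE.
have fin : lam E \is a fin_num by rewrite ge0_fin_numE.
have f0 : fine (lam E) != 0 by rewrite fine_eq0// gt_eqF.
rewrite -(fineK fin) -EFinM => -[] /eqP;
  rewrite -subr_eq0 -{1}[fine _]mulr1 -mulrBr mulf_eq0 (negbTE f0)/=.
by rewrite subr_eq0 => /eqP.
Qed.

Lemma vol_factor1 n : vol_factor (1%:M : 'M[R]_n) = 1.
Proof.
apply: (@vol_factor_id _ _ (cube n 1)); first exact: unitmx1.
- exact: measurable_cube.
- by rewrite lebesgue_rV_cube1 lte_fin exprn_gt0// ltry.
- by apply/seteqP; split=> x; rewrite /premx /= mulmx1.
Qed.

Lemma vol_factor_gt0 n (S : 'M[R]_n) : S \in unitmx -> 0 < vol_factor S.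
Proof.
move=> uS; rewrite lt_def vol_factor_ge0 andbT; apply/eqP => S0.
have := vol_factorM uS (_ : invmx S \in unitmx); rewrite unitmx_inv => /(_ uS)/eqP.
by rewrite mulmxV// vol_factor1 S0 mul0r oner_eq0.
Qed.

(** The preimage of the unit cube is the product of an interval of half-length [|a|^-1] and a
    preimage in dimension [m]. *)
Lemma vol_factor_diag m (a : R) (S : 'M[R]_m) : a != 0 -> S \in unitmx ->
  vol_factor (block_mx a%:M 0 0 S : 'M[R]_(1 + m)) = `|a|^-1 * vol_factor S.
Proof.
move=> a0 uS; have a0' : 0 < `|a| by rewrite normr_gt0.
rewrite /vol_factor.
have -> : premx (block_mx a%:M 0 0 S : 'M[R]_(1 + m)) (cube (1 + m) 1) =
   [set x | `[- `|a|^-1, `|a|^-1]%classic ((x : 'rV_(1 + m)) 0 (lshift m 0)) /\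
     premx S (cube m 1) (rsubmx (x : 'rV_(1 + m)))].
  apply/seteqP; split=> x.
    rewrite /premx /= -[x in x *m _](@hsubmxK _ 1 1 m) (@mul_row_block _ 1 1 m 1 m).
    rewrite !mulmx0 addr0 add0r (@cubeS R m 1) /= in_itv/= -!ler_norml.
    rewrite (@row_mxEl _ 1 1 m) (@row_mxKr _ 1 1 m) mul_mx_scalar !mxE normrM =>
      -[h hS].
    by split=> //; rewrite in_itv/= -ler_norml -[leRHS]mul1r ler_pdivlMr// mulrC.
  rewrite /premx /= => -[]; rewrite in_itv/= -!ler_norml => h1 h2.
  rewrite -[x in x *m _](@hsubmxK _ 1 1 m) (@mul_row_block _ 1 1 m 1 m).
  rewrite !mulmx0 addr0 add0r (@cubeS R m 1) /= in_itv/= -!ler_norml.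
  rewrite (@row_mxEl _ 1 1 m) (@row_mxKr _ 1 1 m) mul_mx_scalar !mxE normrM; split=> //.
  by rewrite mulrC -ler_pdivlMr// mul1r.
rewrite lebesgue_rVX//; last exact: measurable_preimage_mulmx (@measurable_cube R m 1).
rewrite lebesgue_measure_itv/= lte_fin gtrN ?invr_gt0//.
have -> : (`|a|^-1%:E - (- `|a|^-1)%:E)%E = (2 * `|a|^-1)%:E :> \bar R.
  by rewrite -EFinB opprK mulrDl mul1r.
rewrite fineM ?premx_cube_fin//= exprS; field.
by rewrite normr_eq0 a0 expf_neq0// pnatr_eq0.
Qed.

(* A transvection is conjugate to its square. *)
Lemma vol_factor_transvection m (v : 'cV[R]_m) :
  vol_factor (block_mx 1%:M 0 v 1%:M : 'M[R]_(1 + m)) = 1.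
Proof.
pose U w := block_mx 1%:M 0 w 1%:M : 'M[R]_(1 + m).
(* Conjugation by this dilation of the first coordinate doubles [v], and [U (2 *: v)] is the square
   of [U v]. *)
pose D := block_mx (2 : R)%:M 0 0 1%:M : 'M[R]_(1 + m).
have uU w : U w \in unitmx.
  by rewrite unitmxE /U det_lblock !det1 mul1r unitr1.
have uD : D \in unitmx.
  by rewrite unitmxE /D det_lblock det1 det_scalar mulr1 unitfE expf_neq0// pnatr_eq0.
have UU : U (2 *: v) = U v *m U v.
  by rewrite /U mulmx_block !(mulmx0, mul0mx, mulmx1, mul1mx, addr0, add0r)
    scaler_nat mulr2n.
have UD : U v *m D = D *m U (2 *: v).
  by rewrite /U /D mulmx_block !(mulmx0, mul0mx, mulmx1, mul1mx, addr0, add0r)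
     [in RHS]mulmx_block !(mulmx0, mul0mx, mulmx1, mul1mx, addr0, add0r) mul_mx_scalar.
have := congr1 (@vol_factor _) UD; rewrite UU !vol_factorM ?unitmx_mul ?uU//.
have := vol_factor_gt0 (uU v); have := vol_factor_gt0 uD.
rewrite -/(U v); move: (vol_factor (U v)) (vol_factor D) => x y y0 x0 H.
have : x * y * (x - 1) = 0 by rewrite mulrBr mulr1 {2}H; ring.
by move/eqP; rewrite !mulf_eq0 (gt_eqF x0) (gt_eqF y0) subr_eq0 => /eqP.
Qed.

End LinearImage.

(** * Positive definite matrices and Cholesky factorization *)

Section PositiveDefinite.
Variable R : realType.

Definition bform n (M : 'M[R]_n) (x y : 'rV[R]_n) : R := (x *m M *m y^T) 0 0.

Definition spd n (M : 'M[R]_n) :=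
  M^T = M /\ forall x : 'rV[R]_n, x != 0 -> 0 < bform M x x.

Lemma bform_congr n (S M : 'M[R]_n) x y :
  bform (S *m M *m S^T) x y = bform M (x *m S) (y *m S).
Proof. by rewrite /bform trmx_mul !mulmxA. Qed.

Lemma bformC n (M : 'M[R]_n) x y : M^T = M -> bform M x y = bform M y x.
Proof.
move=> sM; have -> : bform M x y = ((x *m M *m y^T)^T) 0 0 by rewrite mxE.
by rewrite !trmx_mul trmxK sM mulmxA.
Qed.

Lemma mulmx_row0_neq0 n (S : 'M[R]_n) (x : 'rV[R]_n) : S \in unitmx -> x != 0 -> x
  *m S != 0.
Proof. by move=> uS; apply: contra_neq => h; rewrite -[x](mulmxK uS) h mul0mx. Qed.

Lemma spd_congr n (S M : 'M[R]_n) : S \in unitmx -> spd M -> spd (S *m M *m S^T).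
Proof.
move=> uS [sM pM]; split; first by rewrite !trmx_mul trmxK sM mulmxA.
by move=> x x0; rewrite bform_congr pM// mulmx_row0_neq0.
Qed.

Lemma spd_unit n (M : 'M[R]_n) : spd M -> M \in unitmx.
Proof.
move=> [sM pM]; rewrite -row_free_unit -kermx_eq0; apply/eqP/row_matrixP => i.
rewrite row0; apply/eqP; apply: contraT => /pM.
have /sub_kermxP E : (row i (kermx M) <= kermx M)%MS by exact: row_sub.
by rewrite /bform E mul0mx mxE ltxx.
Qed.

Lemma spd_inv n (M : 'M[R]_n) : spd M -> spd (invmx M).
Proof.
move=> sM; have uM := spd_unit sM.
have -> : invmx M = invmx M *m M *m (invmx M)^T.
  by rewrite mulVmx// mul1mx trmx_inv sM.1.
by apply: spd_congr => //; rewrite unitmx_inv.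
Qed.

(** Induction through the Schur complement [C]. The factor is a transvection times a block diagonal
    matrix, and for both of these the volume factor is known. *)
Lemma cholesky n (M : 'M[R]_n) : spd M ->
  exists S, [/\ S \in unitmx, M = S *m S^T & vol_factor S = `|\det S|^-1].
Proof.
elim: n M => [|m IH] M [sM pM].
  exists 1%:M; split; first exact: unitmx1.
    by rewrite !flatmx0.
  by rewrite vol_factor1 det1 normr1 invr1.
pose N : 'M[R]_(1 + m) := M.
pose a := N 0 0; pose w : 'cV[R]_m := dlsubmx N; pose v := a^-1 *: w.
pose U (u : 'cV[R]_m) : 'M[R]_(1 + m) := block_mx 1%:M 0 u 1%:M.
have UN u : U u *m U (- u) = 1%:M.
  by rewrite /U mulmx_block !(mulmx0, mul0mx, mulmx1, mul1mx, addr0, add0r) subrr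
    -scalar_mx_block.
have uU u : U u \in unitmx by rewrite unitmxE /U det_lblock !det1 mul1r unitr1.
have a0 : 0 < a.
  have := pM (delta_mx 0 (0 : 'I_m.+1));
    rewrite /bform -rowE trmx_delta -colE !mxE; apply.
  by apply/eqP => /matrixP/(_ 0 0)/eqP; rewrite !mxE !eqxx oner_eq0.
pose C := drsubmx N - a^-1 *: (w *m w^T).
have NE : N = U v *m block_mx a%:M 0 0 C *m (U v)^T.
  rewrite /U tr_block_mx !trmx1 trmx0 !mulmx_block
    !(mulmx0, mul0mx, mulmx1, mul1mx, addr0, add0r) -[LHS]submxK.
  congr block_mx.
  - by apply/matrixP => i j; rewrite !mxE (ord1 i) (ord1 j) mulr1n /a;
    congr (N _ _); apply/val_inj.
  - rewrite mul_scalar_mx /v linearZ/= scalerA divff ?gt_eqF// scale1r /w.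
    by rewrite trmx_dlsub (_ : N^T = N).
  - by rewrite mul_mx_scalar /v scalerA divff ?gt_eqF// scale1r.
  - rewrite mul_mx_scalar /v scalerA divff ?gt_eqF// scale1r linearZ/= -scalemxAr /C.
    by rewrite addrC subrK.
have sC : spd C.
  split.
    rewrite /C linearB linearZ/= trmx_mul trmxK trmx_drsub.
    by rewrite (_ : N^T = N).
  (* [z] is chosen so that [U v] sends it to a vector with first coordinate 0; there the form of [N]
     reduces to that of [C]. *)
  move=> y y0; pose z := (row_mx 0 y : 'rV[R]_(1 + m)) *m U (- v).
  have zU : z *m U v = row_mx 0 y.
    by rewrite -mulmxA -{2}[v]opprK UN mulmx1.
  have z0 : z != 0.
    apply: contra_neq y0 => z0; move: zU; rewrite z0 mul0mx => /(congr1 rsubmx).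
    by rewrite row_mxKr linear0.
  have E : bform (block_mx (a%:M : 'M[R]_1) 0 0 C) (row_mx 0 y) (row_mx 0 y) =
    bform C y y.
    rewrite /bform (@tr_row_mx _ 1 1 m) (@mul_row_block _ 1 1 m 1 m) (@mul_row_col
      _ 1 1 m 1).
    by rewrite !(mulmx0, mul0mx, addr0, add0r).
  by have := pM z z0; rewrite -[M]/N NE bform_congr zU E.
have [S [uS CE vS]] := IH C sC.
pose D : 'M[R]_(1 + m) := block_mx (Num.sqrt a)%:M 0 0 S.
have sa0 : Num.sqrt a != 0 by rewrite gt_eqF// sqrtr_gt0.
have detD : \det D = Num.sqrt a * \det S by rewrite /D det_lblock det_scalar expr1.
have uD : D \in unitmx.
  by rewrite unitmxE detD unitfE mulf_neq0// -unitfE -unitmxE.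
have DE : D *m D^T = block_mx a%:M 0 0 C.
  rewrite /D tr_block_mx !trmx0 mulmx_block !(mulmx0, mul0mx, addr0, add0r) -CE
    tr_scalar_mx.
  by rewrite -scalar_mxM -expr2 sqr_sqrtr// ltW.
have detUD : \det (U v *m D) = Num.sqrt a * \det S.
  by rewrite det_mulmx detD /U det_lblock !det1 !mul1r.
exists (U v *m D); split; first by rewrite unitmx_mul uU.
  by rewrite -[LHS]/N NE -DE trmx_mul !mulmxA.
rewrite vol_factorM// vol_factor_transvection mul1r vol_factor_diag// vS.
rewrite detUD normrM invfM.
by rewrite ger0_norm// sqrtr_ge0.
Qed.

End PositiveDefinite.

(** * Ellipsoids *)

Section TraceDet.
Variable R : realType.

Lemma horner_char_poly n (A : 'M[R]_n) s : (char_poly A).[s] = \det (s%:M - A).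
Proof.
rewrite -horner_evalE -det_map_mx; congr (\det _); apply/matrixP => i j.
by rewrite !mxE /= /horner_eval hornerD hornerN hornerC hornerMn hornerX.
Qed.

(* [det (s + C) = s^n + tr C * s^(n-1) + o(s^(n-1))] *)
Lemma mxtrace_le0 n (C : 'M[R]_n) :
  (forall s, 1 < s -> \det (s%:M + C) <= s ^+ n) -> \tr C <= 0.
Proof.
case: n C => [|n] C Cle; first by rewrite /mxtrace big_ord0.
rewrite leNgt; apply/negP => trC.
(* The monic terms cancel in [d], so a positive trace would be its leading coefficient. *)
pose d := char_poly (- C) - 'X^(n.+1).
have dn : d`_n = \tr C.
  by rewrite coefB coefXn (char_poly_trace (- C) (ltn0Sn n)) ltn_eqF// subr0
    linearN opprK.
have sd : size d = n.+1.
  apply/eqP; rewrite eqn_leq; apply/andP; split; last first.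
    rewrite ltnNge; apply: contraL trC => /leq_sizeP/(_ n (leqnn n)).
    by rewrite dn => ->; rewrite ltxx.
  apply/leq_sizeP => j; rewrite leq_eqVlt => /orP[/eqP<-|nj].
    have := char_poly_monic (- C); rewrite monicE lead_coefE size_char_poly/= => /eqP.
    by rewrite coefB coefXn eqxx => ->; rewrite subrr.
  by rewrite coefB coefXn gtn_eqF// nth_default ?subr0// size_char_poly.
have lc : 0 < lead_coef d by rewrite lead_coefE sd dn.
(* A positive leading coefficient makes [d] positive at all large points; the maximum with 2 ensures
   [1 < s]. *)
have [x0 /(_ (Num.max x0 2))] := polyrcf.poly_pinfty_gt_lc lc.
rewrite le_max lexx => /(_ isT).
have s1 : 1 < Num.max x0 2 by rewrite lt_max ltr1n orbT.
have := Cle _ s1; rewrite /d hornerD hornerN hornerXn horner_char_poly opprK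
  -subr_le0 => h1 h2.
by have := lt_le_trans lc (le_trans h2 h1); rewrite ltxx.
Qed.

End TraceDet.

(** * Scalar products as positive definite matrices *)

Section ScalarProduct.
Variables (R : realType) (n : nat).
Implicit Types (M N : 'M[R]_n) (x y z : 'rV[R]_n) (b : 'rV[R]_n -> 'rV[R]_n -> R).

Lemma bformDl M x y z : bform M (x + y) z = bform M x z + bform M y z.
Proof. by rewrite /bform !mulmxDl mxE. Qed.
Lemma bformDr M x y z : bform M z (x + y) = bform M z x + bform M z y.
Proof. by rewrite /bform linearD /= mulmxDr mxE. Qed.
Lemma bformZl M k x y : bform M (k *: x) y = k * bform M x y.
Proof. by rewrite /bform -!scalemxAl mxE. Qed.
Lemma bformZr M k x y : bform M x (k *: y) = k * bform M x y.
Proof. by rewrite /bform linearZ /= -scalemxAr mxE. Qed.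
Lemma bformBl M x y z : bform M (x - y) z = bform M x z - bform M y z.
Proof. by rewrite -scaleN1r bformDl bformZl mulN1r. Qed.
Lemma bformBr M x y z : bform M z (x - y) = bform M z x - bform M z y.
Proof. by rewrite -scaleN1r bformDr bformZr mulN1r. Qed.
Lemma bform_comb (a b : R) M N x y :
  bform (a *: M + b *: N) x y = a * bform M x y + b * bform N x y.
Proof. by rewrite /bform mulmxDr mulmxDl -!scalemxAr -!scalemxAl !mxE. Qed.
Lemma bform0 M : bform M 0 0 = 0.
Proof. by rewrite /bform !mul0mx mxE. Qed.
Lemma bform_ge0 M x : spd M -> 0 <= bform M x x.
Proof. by move=> [_ pM]; have [->|/pM/ltW//] := eqVneq x 0; rewrite bform0. Qed.

Lemma bform_sum M x y : bform M x y = \sum_i \sum_j x 0 i * M i j * y 0 j.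
Proof.
rewrite /bform mxE exchange_big /=; apply: eq_bigr => j _.
by rewrite !mxE big_distrl.
Qed.

Section DotOfSpd.
Variable M : 'M[R]_n.
Hypothesis sM : spd M.

Let bil : bilinear_for (GRing.Scale.Law.clone _ _ ( *%R ) _) (GRing.Scale.Law.clone
  _ _ (idfun \; *%R ) _) (bform M).
Proof.
by split=> u a x y /=; rewrite ?bformDl ?bformDr ?bformZl ?bformZr.
Qed.
HB.instance Definition _ := bilinear_isBilinear.Build R 'rV[R]_n 'rV[R]_n R _ _
  (bform M) bil.
Let herm x y : bform M x y = (-1) ^+ false * idfun (bform M y x).
Proof. by rewrite expr0 mul1r bformC// sM.1. Qed.
HB.instance Definition _ := isHermitianSesquilinear.Build R 'rV[R]_n false idfun
  (bform M) herm.
HB.instance Definition _ := isDotProduct.Build R 'rV[R]_n (bform M) sM.2.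

Lemma scalar_product_bform : scalar_product (bform M).
Proof. by exists (bform M). Qed.
End DotOfSpd.

(** [M] is the Gram matrix of the standard basis. *)
Lemma scalar_productP b : scalar_product b -> exists2 M, spd M & b = bform M.
Proof.
move=> [f ->]; pose M : 'M[R]_n := \matrix_(i, j) f (delta_mx 0 i) (delta_mx 0 j).
have fM : (f : _ -> _ -> _) = bform M.
  apply/funext => x; apply/funext => y.
  rewrite bform_sum {1}(row_sum_delta x) {1}(row_sum_delta y) linear_sumlz.
  apply: eq_bigr => i _; rewrite linear_sumr; apply: eq_bigr => j _.
  by rewrite linearZl_LR linearZr_LR/= mxE; ring.
exists M => //; split.
  by apply/matrixP => i j; rewrite !mxE [LHS]hermitian_subproof expr0 mul1r.
by move=> x x0; rewrite -fM; exact: neq0_dnorm_gt0.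
Qed.

End ScalarProduct.

(** * Topology and volume of ellipsoids *)

Section Ellipsoid.
Variables (R : realType) (n : nat).
Implicit Types (M N : 'M[R]_n) (x y z : 'rV[R]_n).
Local Notation lam := (@lebesgue_rV R n).
Local Notation ellipsoid M := (unit_ball (bform M) : set (borel_rV R n)).

Lemma continuous_bform M : continuous (fun x => bform M x x).
Proof.
under eq_fun do rewrite bform_sum.
apply: continuous_big => [|i _]; first exact: add_continuous.
apply: continuous_big => [|j _]; first exact: add_continuous.
move=> x; apply: (cvgM (F := nbhs x)); last exact: coord_continuous.
by apply: (cvgM (F := nbhs x)); [exact: coord_continuous|exact: cvg_cst].
Qed.

Lemma measurable_bform M : measurable_fun setT (fun x : borel_rV R n =>
  bform M x x : R).
Proof.
under eq_fun do rewrite bform_sum.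
apply: measurable_sum => i; apply: measurable_sum => j.
apply: measurable_funM; last exact: measurable_coord.
by apply: measurable_funM => //; exact: measurable_coord.
Qed.

Lemma measurable_ellipsoid M : measurable (ellipsoid M).
Proof.
rewrite (_ : unit_ball _ = (fun x : borel_rV R n =>
  bform M x x) @^-1` `]-oo, 1]%classic).
  by rewrite -[X in measurable X]setTI; apply: measurable_bform.
by apply/seteqP; split=> x /=; rewrite in_itv.
Qed.

Lemma measurable_sphere M : measurable ([set x | bform M x x = 1] : set (borel_rV R n)).
Proof.
rewrite (_ : [set x | _] = (fun x : borel_rV R n => bform M x x) @^-1` [set 1])//.
by rewrite -[X in measurable X]setTI; apply: measurable_bform.
Qed.

Lemma closed_ellipsoid M : closed (ellipsoid M : set 'rV[R]_n).
Proof.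
rewrite (_ : unit_ball _ = (fun x => bform M x x) @^-1` [set r | r <= 1])//.
by apply: closed_comp => [x _|]; [exact: continuous_bform|exact: closed_le].
Qed.

(** By continuity, points of value below 1 are interior. A point of value 1 is not: [(1 + t) *: x]
    leaves the ellipsoid for every small [t > 0]. *)
Lemma boundary_ellipsoid M : boundary (ellipsoid M) = [set x | bform M x x = 1].
Proof.
rewrite /boundary -(closure_id _).1; last exact: closed_ellipsoid.
apply/seteqP; split=> x.
  move=> [/= xM xi]; apply/eqP; rewrite eq_le xM /= leNgt; apply/negP => x1; apply: xi.
  have : open [set y | bform M y y < 1].
    rewrite (_ : [set y | _] = (fun y => bform M y y) @^-1` [set r | r < 1])//.
    by apply: open_comp => [y _|]; [exact: continuous_bform|exact: open_lt].
  move=> oM; rewrite /interior; apply: filterS (open_nbhs_nbhs (conj oM x1)).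
  by move=> y /=; exact: ltW.
move=> /= x1; split; first by rewrite /unit_ball /= x1.
move=> xi.
have ct : ((1 + t) *: x) @[t --> (0 : R)] --> (1 + 0 : R) *: x.
  by apply: cvgZr_tmp; apply: cvgD; [exact: cvg_cst|exact: cvg_id].
rewrite addr0 scale1r in ct.
have /nbhs_ballP[e /= e0 eE] := ct _ xi.
have := eE (e / 2); rewrite /ball /= sub0r normrN gtr0_norm ?divr_gt0//.
rewrite ltr_pdivrMr// ltr_pMr// ltr1n => /(_ isT).
by rewrite /unit_ball /= bformZl bformZr x1; nra.
Qed.

Lemma ellipsoid_premx (S : 'M[R]_n) M : ellipsoid (S *m M *m S^T) = premx S
  (ellipsoid M).
Proof. by apply/seteqP; split=> x; rewrite /premx /unit_ball /= bform_congr. Qed.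

Lemma bform1 x : bform 1%:M x x = \sum_i (x 0 i) ^+ 2.
Proof. by rewrite /bform mulmx1 mxE; apply: eq_bigr => i _; rewrite mxE. Qed.

Lemma spd1 : spd (1%:M : 'M[R]_n).
Proof.
split=> [|x x0]; first exact: trmx1.
rewrite bform1 lt_def sumr_ge0 ?andbT => [|i _]; last exact: sqr_ge0.
apply: contra_neq x0 => /psumr_eq0P H; apply/rowP => i; rewrite mxE.
by apply/eqP; rewrite -sqrf_eq0 H// => j _; exact: sqr_ge0.
Qed.

Lemma ellipsoid1_cube : ellipsoid 1%:M `<=` cube n 1.
Proof.
move=> x; rewrite /unit_ball /= bform1 => x1 i.
rewrite -(ler_pXn2r (_ : (0 < 2)%N)) ?nnegrE// expr1n real_normK ?num_real//.
apply: le_trans x1; rewrite (bigD1 i)//= lerDl; apply: sumr_ge0 => j _; exact: sqr_ge0.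
Qed.

(** The radius needs no square root and is positive for [n = 0] too: each of the [n] squares is at
    most [n.+1%:R^-1]. *)
Lemma cube_ellipsoid1 : cube n (n.+1%:R^-1) `<=` ellipsoid 1%:M.
Proof.
move=> x xc; rewrite /unit_ball /= bform1.
have n1 : n.+1%:R^-1 <= 1 :> R by rewrite invf_le1// ler1n.
apply: (@le_trans _ _ (\sum_(i < n) n.+1%:R^-1)).
  apply: ler_sum => i _; rewrite -real_normK ?num_real// expr2.
  rewrite -[leRHS]mulr1; apply: ler_pM => //; exact: le_trans n1.
by rewrite sumr_const card_ord -[_ *+ n]mulr_natl ler_pdivrMr// mul1r ler_nat.
Qed.

Lemma lebesgue_ellipsoid1 : (0 < lam (ellipsoid 1%:M) < +oo)%E.
Proof.
apply/andP; split; last exact: lebesgue_rV_bounded (@measurable_ellipsoid _)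
  ellipsoid1_cube.
apply: (@lt_le_trans _ _ (lam (cube n n.+1%:R^-1))).
  by rewrite lebesgue_rV_cube// lte_fin exprn_gt0// pmulrn_lgt0.
by rewrite le_measure ?inE//; [exact: measurable_cube|exact:
  measurable_ellipsoid|exact: cube_ellipsoid1].
Qed.

Lemma det_spd_gt0 M : spd M -> 0 < \det M.
Proof.
move=> /cholesky[S [uS -> _]]; rewrite det_mulmx det_tr -expr2 exprn_even_gt0//=.
by move: uS; rewrite unitmxE unitfE.
Qed.

(** The Cholesky factor [S] presents the ellipsoid as a preimage of the Euclidean ball, and
    [|\det S|] is the root of [\det M]. *)
Lemma lebesgue_ellipsoid M : spd M ->
  lam (ellipsoid M) = (lam (ellipsoid 1%:M) * ((Num.sqrt (\det M))^-1)%:E)%E.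
Proof.
move=> /cholesky[S [uS -> vS]].
rewrite -[S in S *m _]mulmx1 ellipsoid_premx lebesgue_premx//;
  last exact: measurable_ellipsoid.
by rewrite vS mulmx1 det_mulmx det_tr -expr2 sqrtr_sqr.
Qed.

Lemma lebesgue_ellipsoid_gt0 M : spd M -> (0 < lam (ellipsoid M) < +oo)%E.
Proof.
move=> sM; rewrite lebesgue_ellipsoid//; have /andP[h1 h2] := lebesgue_ellipsoid1.
have M0 : 0 < (Num.sqrt (\det M))^-1 by rewrite invr_gt0 sqrtr_gt0 det_spd_gt0.
by rewrite mule_gt0//= lte_mul_pinfty// ?ltry// ?ge0_fin_numE// ltW.
Qed.

(** Turns maximality of volume into a determinant inequality; the volume of the ball cancels, being
    positive and finite. *)
Lemma volume_ellipsoid_le M N : spd M -> spd N ->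
  (volume (ellipsoid N) <= volume (ellipsoid M))%E = (\det M <= \det N).
Proof.
move=> sM sN.
have E P : spd P -> volume (ellipsoid P) = (lam (ellipsoid 1%:M) * ((Num.sqrt (\det
  P))^-1)%:E)%E.
  by move=> sP; rewrite -(lebesgue_rVE (measurable_ellipsoid P)) lebesgue_ellipsoid.
rewrite (E _ sM) (E _ sN).
have /andP[h1 h2] := lebesgue_ellipsoid1.
rewrite lee_pmul2l// ?ge0_fin_numE ?(ltW h1)// lee_fin.
rewrite lef_pV2 ?posrE ?sqrtr_gt0 ?det_spd_gt0//.
by rewrite ler_psqrt ?nnegrE// ltW// det_spd_gt0.
Qed.

Lemma is_ellipsoidP (F : set 'rV[R]_n) : is_ellipsoid F <-> exists2 M, spd M & F =
  unit_ball (bform M).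
Proof.
split=> [[b /scalar_productP[M sM ->] ->]|[M sM ->]]; first by exists M.
by exists (bform M) => //; exact: scalar_product_bform.
Qed.

End Ellipsoid.

(** * Norm and polar of an ellipsoid *)

Section NormPolar.
Variables (R : realType) (n : nat).
Implicit Types (M N : 'M[R]_n) (x y z : 'rV[R]_n).

Lemma body_norm_ellipsoid M x : spd M -> body_norm (unit_ball (bform M)) x =
  Num.sqrt (bform M x x).
Proof.
move=> sM; rewrite /body_norm; set q := bform M x x;
  have q0 : 0 <= q by exact: bform_ge0.
have -> : [set l | 0 < l /\ [set l *: y | y in unit_ball (bform M)] x] =
    [set l | 0 < l /\ Num.sqrt q <= l].
  apply/seteqP; split=> l /= [l0].
    move=> [y My xE]; split=> //; rewrite -[leRHS]gtr0_norm// -sqrtr_sqr ler_wsqrtr//.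
    by rewrite /q -xE bformZl bformZr mulrA -expr2 ler_piMr// sqr_ge0.
  move=> ql; split=> //; exists (l^-1 *: x);
    last by rewrite scalerA divff ?gt_eqF// scale1r.
  rewrite /unit_ball /= bformZl bformZr mulrA -invfM -/q mulrC ler_pdivrMr
    ?mulr_gt0// mul1r.
  by rewrite -(sqr_sqrtr q0) expr2 ler_pM// sqrtr_ge0.
set A := [set l | _].
have ne : A !=set0.
  exists (Num.sqrt q + 1); split => /=; last by rewrite lerDl.
  by rewrite ltr_wpDl// sqrtr_ge0.
have lb : lbound A (Num.sqrt q) by move=> l [].
apply/eqP; rewrite eq_le lb_le_inf// andbT.
apply/ler_addgt0Pl => e e0; apply: ge_inf; first by exists (Num.sqrt q).
by split => /=; [rewrite ltr_pwDl// sqrtr_ge0|rewrite lerDr ltW].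
Qed.

(** The unit ball determines the norm, hence the quadratic form, and polarization recovers the
    matrix. This makes the choice in [ellipsoid_dot] unambiguous. *)
Lemma unit_ball_bform_inj M N : spd M -> spd N ->
  unit_ball (bform M) = unit_ball (bform N) -> M = N.
Proof.
move=> sM sN MN.
have q x : bform M x x = bform N x x.
  have := body_norm_ellipsoid x sM;
    rewrite MN (body_norm_ellipsoid x sN) => /(congr1 (fun r => r ^+ 2)).
  by rewrite !sqr_sqrtr// ?bform_ge0.
have p x y : bform M x y = bform N x y.
  have := q (x + y); rewrite !bformDl !bformDr (bformC y x sM.1) (bformC y x sN.1)
    !q; lra.
apply/matrixP => i j; have := p (delta_mx 0 i) (delta_mx 0 j).
by rewrite /bform -!rowE !trmx_delta -!colE !mxE.
Qed.

Lemma ellipsoid_dotE M : spd M -> ellipsoid_dot (unit_ball (bform M)) = bform M.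
Proof.
move=> sM; rewrite /ellipsoid_dot;
  case: xgetP => [b _ [/scalar_productP[N sN ->]] /=|/(_ (bform M))[]].
  by move=> /(unit_ball_bform_inj sM sN) ->.
by split => //; exact: scalar_product_bform.
Qed.

(** The functional [bform M x] is represented in the form [N] by [z], and [x] is polar exactly when
    [z] has [N]-norm at most 1. If not, [z] divided by its norm [s] violates the polar
    inequality. *)
Lemma polar_ellipsoid M N : spd M -> spd N ->
  polar (unit_ball (bform M)) (unit_ball (bform N)) = unit_ball (bform (M *m invmx
    N *m M)).
Proof.
move=> sM sN; rewrite /polar ellipsoid_dotE//.
have uN := spd_unit sN.
apply/seteqP; split=> x /=; pose z := x *m M *m invmx N.
  all: have zN y : bform M x y = bform N z y by rewrite /bform /z mulmxKV.
  all: have zz : bform (M *m invmx N *m M) x x = bform N z z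
    by rewrite /bform /z mulmxKV// !trmx_mul trmx_inv sM.1 sN.1 !mulmxA.
  move=> h; rewrite /unit_ball /= zz leNgt; apply/negP => z1.
  pose s := Num.sqrt (bform N z z).
  have s1 : 1 < s by rewrite /s -[ltLHS]sqrtr1 ltr_sqrt// (lt_trans ltr01).
  have sE : bform N z z = s * s by rewrite -expr2 sqr_sqrtr// bform_ge0.
  have s0 : s != 0 by rewrite gt_eqF// (lt_trans ltr01).
  have := h (s^-1 *: z); rewrite zN /unit_ball /= !bformZl !bformZr sE mulKf// mulVf//.
  by rewrite lexx leNgt s1 => /(_ isT).
rewrite /unit_ball /= zz => z1 y y1; rewrite zN.
(* Expanding the square bounds [2 * bform N z y] by the sum of two values that are at most 1. *)
have := bform_ge0 (z - y) sN; rewrite !bformBl !bformBr (bformC y z sN.1); lra.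
Qed.

Lemma spd_polar M N : spd M -> spd N -> spd (M *m invmx N *m M).
Proof.
move=> sM sN; rewrite -{2}sM.1; apply: spd_congr; [exact: spd_unit|exact: spd_inv].
Qed.

End NormPolar.

(** * Ellipsoids inside a convex set and the trace inequality *)

Section Containment.
Variables (R : realType) (n : nat).
Implicit Types (M N : 'M[R]_n) (x y z : 'rV[R]_n) (K : set 'rV[R]_n).

(** The weights are normalized by [a + b], and the missing mass [1 - (a + b)] is put at the
    origin. *)
Lemma convex_subcomb K x y (a b : R) : convex_set (K : set (convex_lmodType
  'rV[R]_n)) ->
  K 0 -> K x -> K y -> 0 <= a -> 0 <= b -> a + b <= 1 -> K (a *: x + b *: y).
Proof.
move=> cK K0 Kx Ky a0 b0 ab.
have cK2 u v t : K u -> K v -> 0 <= t <= 1 -> K (t *: u + (1 - t) *: v).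
  move=> Ku Kv /andP[t0 t1].
  have t01 : t \in `[0, 1] by rewrite in_itv /= t0.
  have := cK u v (Itv01 t0 t1); rewrite !inE => /(_ Ku Kv); exact.
have [ab0|ab0] := eqVneq (a + b) 0.
  have [-> ->] : a = 0 /\ b = 0 by move: ab0 a0 b0; split; lra.
  by rewrite !scale0r addr0.
have abp : 0 < a + b by rewrite lt_def ab0 addr_ge0.
have H1 := cK2 x y (a / (a + b)) Kx Ky.
have {}H1 : K ((a / (a + b)) *: x + (1 - a / (a + b)) *: y).
  by apply: H1; rewrite divr_ge0 ?(ltW abp)//= ler_pdivrMr// mul1r lerDl.
have := cK2 _ _ (a + b) H1 K0; rewrite scaler0 addr0 scalerDr !scalerA.
have -> : (a + b) * (a / (a + b)) = a by field; rewrite ab0.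
have -> : (a + b) * (1 - a / (a + b)) = b by field; rewrite ab0.
by apply; rewrite ltW.
Qed.

Lemma spd_comb M N (t : R) : spd M -> spd N -> 0 < t < 1 -> spd ((1 - t) *: M + t *: N).
Proof.
move=> [sM pM] [sN pN] /andP[t0 t1]; split; first by rewrite linearD !linearZ /= sM sN.
by move=> x x0; rewrite bform_comb addr_gt0// mulr_gt0 ?subr_gt0 ?pM ?pN.
Qed.

(* The squared support function of this ellipsoid interpolates those of the
   ellipsoids of [M] and [N]. *)
Lemma ellipsoid_interpolation K M N (t : R) : convex_set (K : set (convex_lmodType
  'rV[R]_n)) ->
  spd M -> spd N -> unit_ball (bform M) `<=` K -> unit_ball (bform N) `<=` K -> 0 <
    t < 1 ->
  unit_ball (bform (invmx ((1 - t) *: invmx M + t *: invmx N))) `<=` K.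
Proof.
move=> cK sM sN MK NK t01; set H := _ + _ => x.
have sH : spd H by apply: spd_comb => //; exact: spd_inv.
have uH := spd_unit sH.
have K0 : K 0 by apply: MK; rewrite /unit_ball /= bform0.
have [->|x0] := eqVneq x 0; first by [].
(* Since [x = y *m H], the definition of [H] splits [x] into a part for [M] and a part for [N]. *)
pose y := x *m invmx H; have y0 : y != 0 by rewrite mulmx_row0_neq0// unitmx_inv.
have xE : x = (1 - t) *: (y *m invmx M) + t *: (y *m invmx N).
  by rewrite !scalemxAr -mulmxDr -/H /y mulmxKV.
rewrite /unit_ball /= => x1.
pose p := bform (invmx M) y y; pose q := bform (invmx N) y y.
have p0 : 0 < p by apply: (spd_inv sM).2.
have q0 : 0 < q by apply: (spd_inv sN).2.
have pq : (1 - t) * p + t * q <= 1.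
  suff <- : bform (invmx H) x x = (1 - t) * p + t * q by [].
  have -> : bform (invmx H) x x = bform H y y.
    by rewrite /bform /y mulmxKV// trmx_mul trmx_inv sH.1 mulmxA.
  by rewrite /H bform_comb.
(* This is the point of the ellipsoid of [P] at which the pairing with [y] is largest. *)
have inE P : spd P -> (unit_ball (bform P)) ((Num.sqrt (bform (invmx P) y y))^-1 *:
  (y *m invmx P)).
  move=> sP; have P0 : 0 < bform (invmx P) y y by apply: (spd_inv sP).2.
  rewrite /unit_ball /= bformZl bformZr.
  have -> : bform P (y *m invmx P) (y *m invmx P) = bform (invmx P) y y.
    by rewrite /bform mulmxKV ?spd_unit// trmx_mul trmx_inv sP.1 mulmxA.
  by rewrite -{3}(sqr_sqrtr (ltW P0)) expr2 mulKf ?mulVf// gt_eqF// sqrtr_gt0.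
have -> : x = ((1 - t) * Num.sqrt p) *: ((Num.sqrt p)^-1 *: (y *m invmx M)) +
              (t * Num.sqrt q) *: ((Num.sqrt q)^-1 *: (y *m invmx N)).
  by rewrite !scalerA !mulfK ?gt_eqF ?sqrtr_gt0.
move: t01 => /andP[t0 t1].
apply: convex_subcomb => //; try by apply: MK; exact: inE.
- by apply: NK; exact: inE.
- by rewrite mulr_ge0 ?sqrtr_ge0// subr_ge0 ltW.
- by rewrite mulr_ge0 ?sqrtr_ge0// ltW.
(* From [u <= (u ^+ 2 + 1) / 2], the weights add up to at most [((1 - t) * p + t * q + 1) / 2],
   hence to at most 1. *)
- move: pq; rewrite -(sqr_sqrtr (ltW p0)) -(sqr_sqrtr (ltW q0)).
  rewrite !sqrtr_sqr !ger0_norm ?sqrtr_ge0//.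
  move: (Num.sqrt p) (Num.sqrt q) => u v.
  have := mulr_ge0 (ltW t0) (sqr_ge0 (v - 1)).
  have : 0 <= (1 - t) * (u - 1) ^+ 2 by rewrite mulr_ge0 ?sqr_ge0// subr_ge0 ltW.
  lra.
Qed.

Lemma Loewner_John_trace K M N : convex_set (K : set (convex_lmodType 'rV[R]_n)) ->
  spd M -> spd N -> is_Loewner_John K (unit_ball (bform M)) -> unit_ball (bform N)
    `<=` K ->
  \tr (M *m invmx N) <= n%:R.
Proof.
move=> cK sM sN [_ MK maxM] NK; have uM := spd_unit sM.
rewrite -subr_le0 -[n%:R](mxtrace1 R) -linearB /=.
apply: mxtrace_le0 => s s1; have s0 : 0 < s by rewrite (lt_trans ltr01).
have t01 : 0 < s^-1 < 1 by rewrite invr_gt0 s0 invf_lt1.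
(* The interpolation parameter is [s^-1], so that [s *: (M *m H)] equals
   [s%:M + (M *m invmx N - 1%:M)]; maximality gives [\det (M *m H) <= 1]. *)
pose H := (1 - s^-1) *: invmx M + s^-1 *: invmx N.
have sH : spd H by apply: spd_comb => //; exact: spd_inv.
have := maxM (unit_ball (bform (invmx H))).
rewrite volume_ellipsoid_le//; last exact: spd_inv.
have Hell : is_ellipsoid (unit_ball (bform (invmx H))).
  by apply/is_ellipsoidP; exists (invmx H) => //; exact: spd_inv.
move=> /(_ Hell (ellipsoid_interpolation cK sM sN MK NK t01)).
rewrite det_inv -[leRHS]div1r ler_pdivlMr ?det_spd_gt0// -det_mulmx => MH.
have -> : s%:M + (M *m invmx N - 1%:M) = s *: (M *m H).
  rewrite /H mulmxDr -!scalemxAr mulmxV// scalerDr !scalerA mulrBr mulr1 divff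
    ?gt_eqF// scale1r.
  by rewrite scalerBl scale1r scalemx1 addrA addrAC.
by rewrite detZ ler_piMr// exprn_ge0// ltW.
Qed.

End Containment.

(** * The invariant measure on the boundary *)

Section SphereMeasure.
Variables (R : realType) (n : nat) (M : 'M[R]_n).
Hypothesis sM : spd M.
Local Notation lam := (@lebesgue_rV R n).
Local Notation E := (unit_ball (bform M) : set (borel_rV R n)).
Local Notation sphere := ([set x | bform M x x = 1] : set (borel_rV R n)).

Lemma isometry_mulmx (T : {linear 'rV[R]_n -> 'rV[R]_n}) :
  (forall x y, bform M (T x) (T y) = bform M x y) ->
  exists2 P : 'M[R]_n, P \in unitmx & forall x, T x = x *m P.
Proof.
move=> TM; exists (lin1_mx T); last by move=> x; rewrite mul_rV_lin1.
rewrite -row_free_unit -kermx_eq0; apply/eqP/row_matrixP => i; rewrite row0.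
have /sub_kermxP : (row i (kermx (lin1_mx T)) <= kermx (lin1_mx T))%MS by exact:
  row_sub.
rewrite mul_rV_lin1 => T0; apply/eqP; apply: contraT => /sM.2.
by rewrite -TM T0 bform0 ltxx.
Qed.

Lemma lebesgue_isometry (P : 'M[R]_n) (A : set (borel_rV R n)) : P \in unitmx ->
  (forall x, bform M (x *m P) (x *m P) = bform M x x) -> measurable A ->
  lam (premx P A) = lam A.
Proof.
move=> uP MP mA; rewrite lebesgue_premx// (vol_factor_id (E := E)) ?mule1//.
- exact: measurable_ellipsoid.
- exact: lebesgue_ellipsoid_gt0.
- by apply/seteqP; split=> x; rewrite /premx /unit_ball /= MP.
Qed.

(* Junk value: [radial 0 = 0], which is not on the sphere. *)
Definition radial (x : borel_rV R n) : borel_rV R n :=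
  (Num.sqrt (bform M x x))^-1 *: (x : 'rV[R]_n).

Lemma measurable_radial : measurable_fun setT radial.
Proof.
apply: measurable_fun_rV => i;
  (* The inverse square root becomes a real power, which is measurable on the whole line. *)
  under eq_fun do rewrite mxE -powR12_sqrt ?bform_ge0// -powRN.
apply: measurable_funM; last exact: measurable_coord.
exact: (measurableT_comp (measurable_powR _) (measurable_bform M)).
Qed.

Lemma radial_sphere x : x != 0 -> sphere (radial x).
Proof.
move=> /sM.2 x0; rewrite /radial /= bformZl bformZr.
by rewrite -{3}(sqr_sqrtr (ltW x0)) expr2 mulKf ?mulVf// gt_eqF// sqrtr_gt0.
Qed.

Lemma sphere_measure_exists : (0 < n)%N ->
  exists mu : probability (borel_rV R n) R,
    mu (boundary E) = 1%E /\ isometry_invariant (bform M) mu.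
Proof.
move=> n0; have mE : measurable E by exact: measurable_ellipsoid.
have /andP[E0 Eoo] := lebesgue_ellipsoid_gt0 sM.
have fE : lam E \is a fin_num by rewrite ge0_fin_numE// ltW.
pose m := image_measure (mrestr lam mE) measurable_radial.
have mT : m setT = lam E by rewrite /m /= /pushforward /mrestr preimage_setT setTI.
have mrad A : measurable A -> measurable (radial @^-1` A).
  by move=> mA; rewrite -[X in measurable X]setTI; exact: measurable_radial.
(* [mnormalize] falls back on the Dirac measure only for total mass zero or infinity, both excluded
   for an ellipsoid. *)
pose mu : probability (borel_rV R n) R := mnormalize m (dirac (0 : borel_rV R n)).
have muE A : mu A = (lam (radial @^-1` A `&` E) * (fine (lam E))^-1%:E)%E.
  by rewrite /mu /= /mnormalize mT gt_eqF//= lt_eqF.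
exists mu; split.
  rewrite muE boundary_ellipsoid.
  suff -> : lam (radial @^-1` sphere `&` E) = lam E.
    by rewrite -{1}(fineK fE) -EFinM divff// fine_eq0// gt_eqF.
  have mS : measurable (radial @^-1` sphere `&` E).
    by apply: measurableI => //; apply: mrad; exact: measurable_sphere.
  apply/eqP; rewrite eq_le; apply/andP; split; first by rewrite le_measure// inE.
  rewrite -[leRHS]adde0.
  (* Only the origin of [E] is not sent to the sphere; it lies in the cube of radius 0, of measure
     [0 ^+ n = 0] because [n > 0]. *)
  have <- : lam (cube n 0) = 0%E by rewrite lebesgue_rV_cube// mul0rn expr0n eqn0Ngt n0.
  apply: le_trans (measureU2 _ _ _) => //; last exact: measurable_cube.
  rewrite le_measure ?inE//; first by apply: measurableU => //; exact: measurable_cube.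
  move=> x Ex; have [->|x0] := eqVneq (x : 'rV_n) 0.
    by right => i; rewrite mxE normr0.
  by left; split => //; exact: radial_sphere.
move=> T TM A mA; rewrite !muE; congr (_ * _)%E.
have [P uP TP] := isometry_mulmx TM.
have PM x : bform M (x *m P) (x *m P) = bform M x x by rewrite -!TP TM.
rewrite -[RHS](@lebesgue_isometry P _ uP PM); last first.
  by apply: measurableI => //; exact: mrad.
(* [radial] commutes with the isometry, and [E] is invariant under it. *)
by congr (lam _); apply/seteqP; split=> x;
  rewrite /premx /unit_ball /= /radial /= TP PM -scalemxAl.
Qed.

(** * Second moments of an invariant probability measure on the sphere *)

Variable mu : probability (borel_rV R n) R.
Hypothesis mu1 : mu (boundary E) = 1%E.
Hypothesis muM : isometry_invariant (bform M) mu.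

Let mS : measurable sphere. Proof. exact: measurable_sphere. Qed.

Lemma integrable_sphere (f : borel_rV R n -> R) : measurable_fun setT f ->
  (forall x, sphere x -> `|f x| <= 1) -> mu.-integrable sphere (EFin \o f).
Proof.
move=> mf f1; apply: measurable_bounded_integrable => //.
- by rewrite (le_lt_trans (probability_le1 _ _))// ltry.
- exact: measurable_funS mf.
- exists 1; split => // t t1 x /f1 /le_trans; apply; exact: ltW.
Qed.

(** Change of variables: by invariance, the image of [mu] under [P] is [mu], and the sphere is its
    own preimage. The bound on [f] provides integrability. *)
Lemma integral_isometry (P : 'M[R]_n) (f : borel_rV R n -> R) :
  (forall x y, bform M (x *m P) (y *m P) = bform M x y) ->
  measurable_fun setT f -> (forall x, sphere x -> `|f x| <= 1) ->
  (\int[mu]_(x in sphere) (f x)%:E =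
   \int[mu]_(x in sphere) (f ((x : 'rV_n) *m P))%:E)%E.
Proof.
move=> PM mf f1.
have SP : (fun x : borel_rV R n =>
  (x : 'rV_n) *m P : borel_rV R n) @^-1` sphere = sphere.
  by apply/seteqP; split=> x; rewrite /= PM.
have := @integral_pushforward _ _ _ _ R _ (measurable_mulmx P) mu sphere (EFin \o f).
rewrite SP => <- //.
- apply: (eq_measure_integral (image_measure mu (measurable_mulmx P))) => A mA _.
  by have := muM (T := mulmxr P) PM mA.
- exact/measurable_EFinP.
- apply: (integrable_sphere (f := fun x => f ((x : 'rV_n) *m P))).
    exact: (measurableT_comp mf (measurable_mulmx P)).
  by move=> x x1; apply: f1; rewrite /= PM.
Qed.

Variable S : 'M[R]_n.
Hypotheses (uS : S \in unitmx) (MS : M = S *m S^T).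

(** The entries of [x *m S] are coordinates in an [M]-orthonormal basis; an orthogonal [Q] in these
    coordinates is an isometry of [M]. *)
Lemma bform_orthogonal (Q : 'M[R]_n) : Q *m Q^T = 1%:M ->
  forall x y, bform M (x *m (S *m Q *m invmx S)) (y *m (S *m Q *m invmx S)) = bform
    M x y.
Proof.
move=> QQ x y; rewrite -bform_congr; congr (bform _ _ _).
rewrite MS !trmx_mul trmx_inv !mulmxA mulmxKV// -!mulmxA mulKVmx ?unitmx_tr//.
by rewrite [Q *m _]mulmxA QQ mul1mx.
Qed.

Let g i j (x : borel_rV R n) : R := ((x : 'rV_n) *m S) 0 i * ((x : 'rV_n) *m S) 0 j.

Lemma bform_factor x : bform M x x = \sum_i ((x *m S) 0 i) ^+ 2.
Proof. by rewrite MS -[S in S *m _]mulmx1 bform_congr bform1. Qed.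

Let measurable_g i j : measurable_fun setT (g i j).
Proof.
by apply: measurable_funM; apply: (measurableT_comp (measurable_coord _)
  (measurable_mulmx S)).
Qed.

Let coord_le1 i x : sphere x -> `|((x : 'rV_n) *m S) 0 i| <= 1.
Proof.
rewrite /= bform_factor => x1.
rewrite -(ler_pXn2r (_ : (0 < 2)%N)) ?nnegrE// expr1n real_normK ?num_real// -x1.
by rewrite (bigD1 i)//= lerDl; apply: sumr_ge0 => j _; exact: sqr_ge0.
Qed.

Let g_le1 i j x : sphere x -> `|g i j x| <= 1.
Proof.
by move=> x1; rewrite normrM -[leRHS]mulr1; apply: ler_pM => //; exact: coord_le1.
Qed.

Let integrable_g i j := integrable_sphere (measurable_g i j) (g_le1 i j).

Let integral_g_orthogonal (Q : 'M[R]_n) i j : Q *m Q^T = 1%:M ->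
  (\int[mu]_(x in sphere) (g i j x)%:E =
   \int[mu]_(x in sphere) (((x : 'rV_n) *m S *m Q) 0 i * ((x : 'rV_n) *m S *m Q) 0
     j)%:E)%E.
Proof.
move=> QQ; rewrite (integral_isometry (bform_orthogonal QQ) (measurable_g i j))//;
  last first.
  exact: g_le1.
by apply: eq_integral => x _; rewrite /g !mulmxA mulmxKV.
Qed.

Lemma integral_g_neq i j : i != j -> (\int[mu]_(x in sphere) (g i j x)%:E = 0)%E.
Proof.
(* Reversing the sign of coordinate [i] alone negates the integrand, so the integral equals its
   opposite. *)
move=> ij; pose d : 'rV[R]_n := \row_k (if k == i then -1 else 1).
have dd : diag_mx d *m (diag_mx d)^T = 1%:M.
  rewrite tr_diag_mx mulmx_diag; apply/matrixP => k l; rewrite !mxE.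
  by case: (k == i); rewrite ?mulrNN mulr1.
have H := integral_g_orthogonal i j dd.
have : (\int[mu]_(x in sphere) (g i j x)%:E = - \int[mu]_(x in sphere) (g i j x)%:E)%E.
  rewrite -muleN1 muleC {1}H -(integralZl mS (integrable_g i j)).
  apply: eq_integral => x _; rewrite mul_mx_diag !mxE eqxx eq_sym (negbTE ij) /g /=
    -EFinM.
  by congr EFin; rewrite !mxE; ring.
have := integrable_fin_num mS (integrable_g i j).
case: (integral _ _ _) => // r _ []; move=> r0; congr EFin; lra.
Qed.

(** Transposing two coordinates shows that all [n] integrals are equal; they add up to the integral
    of [bform M x x], which is 1 on the sphere. *)
Lemma integral_g_eq i : (\int[mu]_(x in sphere) (g i i x)%:E = (n%:R^-1)%:E)%E.
Proof.
have gij j : (\int[mu]_(x in sphere) (g j j x)%:E = \int[mu]_(x in sphere) (g i i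
  x)%:E)%E.
  have QQ : (tperm_mx i j : 'M[R]_n) *m (tperm_mx i j)^T = 1%:M.
    by rewrite tr_tperm_mx /tperm_mx -perm_mxM perm.tperm2 perm_mx1.
  rewrite (integral_g_orthogonal j j QQ).
  have tE (u : 'rV[R]_n) : (u *m tperm_mx i j) 0 j = u 0 i.
    by rewrite -xcolE mxE perm.tpermR.
  by apply: eq_integral => x _; rewrite !tE.
have sum1 : (\sum_j \int[mu]_(x in sphere) (g j j x)%:E = 1)%E.
  rewrite -(integral_sum mS (fun j => integrable_g j j)).
  rewrite (eq_integral (fun=> 1%E)); last first.
    move=> x /set_mem /= x1; rewrite sumEFin; congr EFin.
    by rewrite -[RHS]x1 bform_factor; apply: eq_bigr => j _; rewrite /g expr2.
  by rewrite integral_cst// mul1e; have := mu1; rewrite boundary_ellipsoid.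
move: sum1; rewrite (eq_bigr _ (fun j _ => gij j)).
have := integrable_fin_num mS (integrable_g i i).
case: (integral _ _ _) => // r _; rewrite sumEFin => -[].
rewrite sumr_const card_ord => nr; congr EFin.
have n0 : n%:R != 0 :> R.
  by apply/eqP => n0; move: nr; rewrite -mulr_natl n0 mul0r => /eqP;
    rewrite eq_sym oner_eq0.
by apply: (mulfI n0); rewrite mulr_natl nr divff.
Qed.

(** [A] is the matrix of the form [Q] in orthonormal coordinates. Only its diagonal contributes,
    giving [\tr A / n%:R], and the trace is cyclic. *)
Lemma integral_bform_sphere (Q : 'M[R]_n) :
  (\int[mu]_(x in sphere) (bform Q x x)%:E = (\tr (Q *m invmx M) / n%:R)%:E)%E.
Proof.
pose A := invmx S *m Q *m (invmx S)^T.
have QA (x : 'rV_n) : bform Q x x = \sum_i \sum_j A i j * g i j x.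
  have -> : Q = S *m A *m S^T.
    rewrite /A !mulmxA mulmxV// mul1mx -mulmxA -trmx_mul mulmxV//.
    by rewrite trmx1 mulmx1.
  rewrite bform_congr bform_sum; apply: eq_bigr => i _; apply: eq_bigr => j _.
  by rewrite /g; ring.
transitivity (\int[mu]_(x in sphere) (\sum_i (\sum_j (A i j)%:E * (g i j x)%:E)))%E.
  apply: eq_integral => x _; rewrite QA -sumEFin; apply: eq_bigr => i _.
  by rewrite -sumEFin.
have intA i j : mu.-integrable sphere (fun x => (A i j)%:E * (g i j x)%:E)%E.
  exact/integrableZl/integrable_g.
rewrite (integral_sum mS); last by move=> i; exact: integrable_sum.
rewrite (eq_bigr (fun i => (A i i / n%:R)%:E)); last first.
  move=> i _; rewrite (integral_sum mS)// (bigD1 i)//= big1 ?adde0 => [|j ji].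
    by rewrite (integralZl mS (integrable_g i i)) integral_g_eq.
  by rewrite (integralZl mS (integrable_g i j)) integral_g_neq ?mule0// eq_sym.
rewrite sumEFin -mulr_suml -/(\tr A) /A mxtrace_mulC mulmxA.
have MV : M *m ((invmx S)^T *m invmx S) = 1%:M.
  by rewrite MS trmx_inv mulmxA mulmxK ?unitmx_tr// mulmxV.
by rewrite -[(invmx S)^T *m _](mulKmx (spd_unit sM)) MV mulmx1 mxtrace_mulC.
Qed.

End SphereMeasure.

(** On the sphere the squared polar norm is the form of [M *m invmx N *m M], so its mean is a trace
    in which one factor [M] cancels. Existence of an invariant measure guarantees that [get] returns
    one. *)
Lemma ellipsoid_MstarE (R : realType) n (M N : 'M[R]_n) : (0 < n)%N -> spd M -> spd N ->
  ellipsoid_Mstar (unit_ball (bform M)) (unit_ball (bform N)) =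
  (Num.sqrt (\tr (M *m invmx N) / n%:R))%:E.
Proof.
move=> n0 sM sN; rewrite /ellipsoid_Mstar /ellipsoid_M polar_ellipsoid//.
set mu := ellipsoid_measure _.
have [mu1 muM] : mu (boundary (unit_ball (bform M))) = 1%E /\ isometry_invariant
  (bform M) mu.
  have [nu nuP] := sphere_measure_exists sM n0.
  rewrite /mu /ellipsoid_measure ellipsoid_dotE//.
  exact: (@getPex _ [set mu : probability (borel_rV R n) R | mu (boundary
    (unit_ball (bform M))) = 1%E /\
    isometry_invariant (bform M) mu] (ex_intro _ nu nuP)).
have [S [uS MS _]] := cholesky sM.
rewrite boundary_ellipsoid; have sQ := spd_polar sM sN.
under eq_integral do rewrite body_norm_ellipsoid// sqr_sqrtr ?bform_ge0//.
by rewrite (integral_bform_sphere sM mu1 muM uS MS) mulmxK ?spd_unit.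
Qed.

(** * A further case of equality *)

Section Square.
Variable R : realType.

Lemma is_body_cube n : is_body (cube n 1 : set 'rV[R]_n).
Proof.
split.
- have cI : compact [set v : 'rV[R]_n | forall i, v ord0 i \in `[(-1), 1]].
    have := @rV_compact R n (fun=> `[(-1), 1]%classic).
    apply.
    by move=> i; exact: segment_compact.
  rewrite (_ : cube n 1 = [set v : 'rV[R]_n | forall i, v ord0 i \in `[(-1), 1]])//.
  by apply/seteqP; split=> x xc i; have := xc i; rewrite /= in_itv/= ler_norml.
- move=> x y k; rewrite !inE => xc yc i.
  have -> : (conv k x y : 'rV[R]_n) 0 i = k%:num * (x : 'rV_n) 0 i + (1 - k%:num) *
    (y : 'rV_n) 0 i.
    by rewrite !mxE.
  have := xc i; have := yc i; rewrite !ler_norml => /andP[y1 y2] /andP[x1 x2].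
  have k0 : 0 <= k%:num by []. have k1 : 0 <= 1 - k%:num by rewrite subr_ge0.
  by apply/andP; split; nra.
- apply/seteqP; split=> x xc.
    by exists (- x); [move=> i; rewrite mxE normrN; exact: xc|rewrite opprK].
  by case: xc => y yc <- i; rewrite mxE normrN; exact: yc.
- exists 0; rewrite /interior; apply/nbhs_ballP; exists 1 => //= x [_ x1] i.
  by have := x1 0 i; rewrite mxE /ball /= sub0r normrN => /ltW.
Qed.

(** The entry [invmx N i i] is the squared maximum of coordinate [i] on the ellipsoid, attained at
    the normalized row [i] of [invmx N]. *)
Lemma ellipsoid_cube_diag n (N : 'M[R]_n) i : spd N -> unit_ball (bform N) `<=`
  cube n 1 ->
  0 < invmx N i i <= 1.
Proof.
move=> sN Nc; have uN := spd_unit sN.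
have hE : bform (invmx N) (delta_mx 0 i) (delta_mx 0 i) = invmx N i i.
  by rewrite /bform -rowE trmx_delta -colE !mxE.
have h0 : 0 < invmx N i i.
  rewrite -hE; apply: (spd_inv sN).2; apply/eqP => /matrixP/(_ 0 i)/eqP.
  by rewrite !mxE !eqxx oner_eq0.
rewrite h0 /=; set s := Num.sqrt (invmx N i i).
have s0 : 0 < s by rewrite sqrtr_gt0.
have ss : invmx N i i = s * s by rewrite -expr2 sqr_sqrtr// ltW.
have := Nc (s^-1 *: (delta_mx 0 i *m invmx N)).
rewrite /unit_ball /= bformZl bformZr.
have -> : bform N (delta_mx 0 i *m invmx N) (delta_mx 0 i *m invmx N) = s * s.
  by rewrite -ss -hE /bform mulmxKV// trmx_mul trmx_inv sN.1 mulmxA.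
rewrite mulKf ?gt_eqF// mulVf ?gt_eqF// lexx => /(_ isT)/(_ i).
rewrite mxE -rowE mxE ss mulKf ?gt_eqF// gtr0_norm// => s1.
by rewrite -[leRHS]mulr1 ler_pM// ltW.
Qed.

Lemma det22 (A : 'M[R]_2) : \det A = A 0 0 * A 1 1 - A 0 1 * A 1 0.
Proof.
rewrite (expand_det_row _ 0) big_ord_recl big_ord1 /cofactor !det_mx11 !mxE /=.
rewrite expr0 expr1 !mul1r.
have -> : lift 0 (0 : 'I_1) = 1 :> 'I_2 by apply/val_inj.
have -> : lift 1 (0 : 'I_1) = 0 :> 'I_2 by apply/val_inj.
by rewrite mulN1r mulrN.
Qed.

(** The inverse matrix of an inscribed ellipse has diagonal entries [a], [b] in []0, 1]], so its
    determinant [a * b - c ^+ 2] is at most 1. *)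
Lemma Loewner_John_square : is_Loewner_John (cube 2 1) (unit_ball (bform (1%:M :
  'M[R]_2))).
Proof.
split; first by apply/is_ellipsoidP; exists 1%:M => //; exact: spd1.
  exact: ellipsoid1_cube.
move=> _ /is_ellipsoidP[N sN ->] Nc; rewrite volume_ellipsoid_le//; last exact: spd1.
have d0 := det_spd_gt0 (spd_inv sN).
rewrite det1 -[N]invmxK det_inv invf_ge1// det22.
have /andP[a0 a1] := ellipsoid_cube_diag 0 sN Nc.
have /andP[b0 b1] := ellipsoid_cube_diag 1 sN Nc.
have -> : invmx N 1 0 = invmx N 0 1 by rewrite -[in LHS](spd_inv sN).1 mxE.
have := sqr_ge0 (invmx N 0 1); nra.
Qed.

(** The inverse of the matrix of the second ellipse. The unit diagonal makes it touch all four sides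
    and gives trace 2; any nonzero off-diagonal value in []-1, 1[] would do. *)
Definition skew_mx : 'M[R]_2 := \matrix_(i, j) (if i == j then 1 else 2^-1).

Lemma bform_skew_mx (y : 'rV[R]_2) :
  bform skew_mx y y = (y 0 0) ^+ 2 + y 0 0 * y 0 1 + (y 0 1) ^+ 2.
Proof.
rewrite bform_sum !big_ord_recl !big_ord0 !mxE /=.
have -> : lift 0 (0 : 'I_1) = 1 :> 'I_2 by apply/val_inj.
by field.
Qed.

Lemma spd_skew_mx : spd skew_mx.
Proof.
split; first by apply/matrixP => i j; rewrite !mxE eq_sym.
move=> y; apply: contraNT; rewrite -leNgt bform_skew_mx => y0.
have h1 : y 0 1 = 0.
  apply/eqP; rewrite -sqrf_eq0 eq_le sqr_ge0 andbT.
  (* Completing the square leaves [3 / 4 * (y 0 1) ^+ 2]. *)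
  have := sqr_ge0 (y 0 0 + y 0 1 / 2); lra.
have h0 : y 0 0 = 0.
  by apply/eqP; rewrite -sqrf_eq0 eq_le sqr_ge0 andbT; move: y0; rewrite h1; lra.
apply/eqP/rowP => i; rewrite mxE; case: i => -[|[|//]] ip.
  by rewrite -[RHS]h0; congr (y _ _); apply/val_inj.
by rewrite -[RHS]h1; congr (y _ _); apply/val_inj.
Qed.

(** The form equals [(x 0 0) ^+ 2 + 3 / 4 * (y 0 1) ^+ 2], and likewise with the indices exchanged,
    so both coordinates of [x] have square at most 1. *)
Lemma skew_ellipsoid_cube : unit_ball (bform (invmx skew_mx)) `<=` cube 2 1.
Proof.
move=> x; have uH := spd_unit spd_skew_mx.
pose y := x *m invmx skew_mx; have xE : x = y *m skew_mx by rewrite /y mulmxKV.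
have -> : unit_ball (bform (invmx skew_mx)) x = (bform skew_mx y y <= 1).
  by rewrite /unit_ball /= /bform -/y xE trmx_mul spd_skew_mx.1 mulmxA.
rewrite bform_skew_mx => y1.
have x0E : x 0 0 = y 0 0 + y 0 1 / 2.
  rewrite xE mxE !big_ord_recl big_ord0 !mxE /=.
  have -> : lift 0 (0 : 'I_1) = 1 :> 'I_2 by apply/val_inj.
  by field.
have x1E : x 0 1 = y 0 0 / 2 + y 0 1.
  rewrite xE mxE !big_ord_recl big_ord0 !mxE /=.
  have -> : lift 0 (0 : 'I_1) = 1 :> 'I_2 by apply/val_inj.
  by field.
move=> i; case: i => -[|[|//]] ip.
  rewrite (_ : Ordinal ip = 0) ?x0E; last exact/val_inj.
  by rewrite ler_norml; apply/andP; split; nra.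
rewrite (_ : Ordinal ip = 1) ?x1E; last exact/val_inj.
by rewrite ler_norml; apply/andP; split; nra.
Qed.

End Square.

Theorem corollary5p2 (R : realType) :
  (forall (n : nat) (K E : set 'rV[R]_n),
     (0 < n)%N -> is_body K -> is_Loewner_John K E ->
     (forall F : set 'rV[R]_n, is_ellipsoid F -> F `<=` K ->
        (ellipsoid_Mstar E F <= 1)%E) /\
     ellipsoid_Mstar E E = 1%E) /\
  (exists (n : nat) (K E F : set 'rV[R]_n),
     [/\ (0 < n)%N, is_body K & is_Loewner_John K E] /\
     [/\ is_ellipsoid F, F `<=` K, F <> E & ellipsoid_Mstar E F = 1%E]).
Proof.
split=> [n K E n0 [_ cK _ _] KE|].
  have n1 : 0 < n%:R :> R by rewrite ltr0n.
  have [/is_ellipsoidP[M sM EM] _ _] := KE; rewrite {E}EM in KE *.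
  split; last first.
    by rewrite ellipsoid_MstarE// mulmxV ?spd_unit// mxtrace1 divff ?gt_eqF// sqrtr1.
  move=> _ /is_ellipsoidP[N sN ->] NK.
  rewrite ellipsoid_MstarE// lee_fin -[leRHS]sqrtr1 ler_wsqrtr//.
  by rewrite ler_pdivrMr// mul1r (Loewner_John_trace cK sM sN KE NK).
exists 2%N, (cube 2 1), (unit_ball (bform 1%:M)), (unit_ball (bform (invmx (skew_mx
  R)))).
have s1 := @spd1 R 2; have sH := spd_skew_mx R; have sN := spd_inv sH.
split; first by split; [by []|exact: is_body_cube|exact: Loewner_John_square].
split.
- by apply/is_ellipsoidP; exists (invmx (skew_mx R)).
- exact: skew_ellipsoid_cube.
(* Equal ellipses would have equal inverse matrices, but these differ at the entry [(0, 1)]. *)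
- move=> /(unit_ball_bform_inj sN s1)/(congr1 invmx);
  rewrite invmxK invmx1 => /matrixP/(_ 0 1)/eqP.
  by rewrite !mxE /= invr_eq0 pnatr_eq0.
(* The first matrix being the identity, the trace is that of [skew_mx], namely 2, which is also the
   dimension. *)
- rewrite ellipsoid_MstarE// mul1mx invmxK /mxtrace !big_ord_recl big_ord0 !mxE /=.
  by rewrite addr0 -[1 + 1]/(2%:R) divff ?pnatr_eq0// sqrtr1.
Qed.
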